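(* For any $q>1$ and $\varepsilon>0$ there exists a constant $\alpha(q,\varepsilon)$ such that for all $s\ge v\ge0$, as $\gamma\to\infty$, $$\mathbb{P}\Big(\sup_{i\in\mathcal{J}}\sum_{j\in\mathcal{J}}\big|\hat p^{\mathrm{a}}_{ij}(s)-\tilde p^{\mathrm{a}}_{ij}(s)\big|\ge(s+1)\,\alpha(q,\varepsilon)\,(\log\gamma)\,\gamma^{-1/2+\varepsilon/2}\Big)=o(\gamma^{-q}),$$ $$\mathbb{P}\Big(\sup_{i\in\mathcal{J}}\int_0^v\sum_{j\in\mathcal{J}}\big|\hat p^{\mathrm{c}}_{ij}(s,v')-\tilde p^{\mathrm{c}}_{ij}(s,v')\big|\,\mathrm{d}v'\ge(s+1)\,\alpha(q,\varepsilon)\,(\log\gamma)\,\gamma^{-1/2+\varepsilon/2}\Big)=o(\gamma^{-q}).$$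
   Context: $\mathrm{Poi}_\lambda(k)=e^{-\lambda}\lambda^k/k!$ for $k\ge 0$, and $\mathrm{Erl}_{k,\lambda}(x)=\lambda(\lambda x)^{k-1}e^{-\lambda x}/(k-1)!$ for $k\ge1$, $x\ge0$. $\mathcal{J}=\{1,\dots,J\}$ is a finite set. $\{\boldsymbol{\Lambda}(s,v)\}_{s,v\ge0}$ is a family of intensity matrices on $\mathcal{J}$ (nonnegative off-diagonal entries, zero row sums) with $\sup_{s,v\ge0,\,i\in\mathcal{J}}|\Lambda_{ii}(s,v)|\le\gamma_0$ for some $\gamma_0\in(0,\infty)$, and Lipschitz: there is $K>0$ such that for all $s_1,s_2,v_1,v_2\ge0$, $$\sup_{i\in\mathcal{J}}\sum_{j\in\mathcal{J}}|\Lambda_{ij}(s_1,v_1)-\Lambda_{ij}(s_2,v_2)|\le K(|s_1-s_2|+|v_1-v_2|).$$ For $\gamma\ge\gamma_0$ let $\chi_0=0<\chi_1<\chi_2<\cdots$ be the arrival times of a Poisson process $\Gamma$ of intensity $\gamma$. For integers $\ell\ge w\ge0$ set $$\boldsymbol{Q}(\ell,w)=\boldsymbol{I}+\tfrac1\gamma\boldsymbol{\Lambda}(\chi_{\ell+1},\chi_{\ell+1}-\chi_{\ell-w}),\qquad \tilde{\boldsymbol{Q}}(\ell,w)=\boldsymbol{I}+\tfrac1\gamma\boldsymbol{\Lambda}\big(\tfrac{\ell+1}\gamma,\tfrac{w+1}\gamma\big).$$ $\boldsymbol{Q}^{\mathrm{d}}$ is the diagonal matrix with the diagonal of $\boldsymbol{Q}$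 and $\boldsymbol{Q}^{\mathrm{n}}=\boldsymbol{Q}-\boldsymbol{Q}^{\mathrm{d}}$; similarly $\tilde{\boldsymbol{Q}}^{\mathrm{d}},\tilde{\boldsymbol{Q}}^{\mathrm{n}}$. The matrices $\boldsymbol{\Pi}(\ell,w)$ are given by $\boldsymbol{\Pi}(0,0)=\boldsymbol{I}$; $\boldsymbol{\Pi}(k,v)=\boldsymbol{0}$ for $v>k$; $\boldsymbol{\Pi}(k,0)=\sum_{k'=0}^{k-1}\boldsymbol{\Pi}(k-1,k')\boldsymbol{Q}^{\mathrm{n}}(k-1,k')$ for $k\ge1$; $\boldsymbol{\Pi}(k,v)=\boldsymbol{\Pi}(k-1,v-1)\boldsymbol{Q}^{\mathrm{d}}(k-1,v-1)$ for $k\ge v\ge1$. The matrices $\tilde{\boldsymbol{\Pi}}(\ell,w)$ are given by the same recursion with $\tilde{\boldsymbol{Q}}^{\mathrm{d}},\tilde{\boldsymbol{Q}}^{\mathrm{n}}$ in place of $\boldsymbol{Q}^{\mathrm{d}},\boldsymbol{Q}^{\mathrm{n}}$. The (random) grid-conditional transition quantities are $$\hat p^{\mathrm{a}}_{ij}(s)=\sum_{\ell\ge0}\mathrm{Poi}_{\gamma s}(\ell)\,\Pi_{ii}(\ell,\ell)\,\mathbf 1_{\{i=j\}},\qquad \hat p^{\mathrm{c}}_{ij}(s,v)=\sum_{\ell>w\ge0}\mathrm{Erl}_{\ell-w,\gamma}(s-v)\,\mathrm{Poi}_{\gamma v}(w)\,\Pi_{ij}(\ell,w)\,\mathbf 1_{\{v<s\}},$$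 and the (deterministic) unconditional ones are $$\tilde p^{\mathrm{a}}_{ij}(s)=\sum_{\ell\ge0}\mathrm{Poi}_{\gamma s}(\ell)\,\tilde\Pi_{ii}(\ell,\ell)\,\mathbf 1_{\{i=j\}},\qquad \tilde p^{\mathrm{c}}_{ij}(s,v)=\sum_{\ell>w\ge0}\mathrm{Erl}_{\ell-w,\gamma}(s-v)\,\mathrm{Poi}_{\gamma v}(w)\,\tilde\Pi_{ij}(\ell,w)\,\mathbf 1_{\{v<s\}}.$$ All of these depend on $\gamma$. *)

(* Defs.v *)
From HB Require Import structures.
From mathcomp Require Import all_boot all_order all_algebra.
From mathcomp Require Import all_classical all_reals all_analysis.

Set Implicit Arguments.
Unset Strict Implicit.
Unset Printing Implicit Defensive.

Import Order.TTheory GRing.Theory Num.Theory.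
Import numFieldNormedType.Exports.

Local Open Scope classical_set_scope.
Local Open Scope ring_scope.

(* The packaged filter at +oo, needed for Landau notations at +oo. *)
Canonical pinfty_filterType (R : realType) :=
  FilterType (pinfty_nbhs R) (@filter_filter R _ proper_pinfty_nbhs).

Section PoissonErlang.
Context {R : realType}.

(* The library's [poisson_pmf] takes the value 1 at every k when the rate is 0;
   with [0 ^+ 0 = 1], [Poi 0] is the unit mass at 0. *)
Definition Poi (l : R) (k : nat) : R := expR (- l) * l ^+ k / k`!%:R.

Definition Erl (k : nat) (l x : R) : R :=
  l * (l * x) ^+ k.-1 * expR (- (l * x)) / (k.-1)`!%:R.

End PoissonErlang.

Section PoissonProcess.
Context {R : realType} {d : measure_display} {T : measurableType d}.
Variable P : probability T R.

Record poisson_process (g : R) (N : R -> T -> nat) : Prop := {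
  pp_measurable : forall t, 0 <= t -> measurable_fun [set: T] (N t);
  pp_start : forall w, N 0 w = 0%N;
  pp_mono : forall w s t, 0 <= s -> s <= t -> (N s w <= N t w)%N;
  pp_increments : forall s t k, 0 <= s -> s <= t ->
    P [set w | (N t w - N s w)%N = k] = (Poi (g * (t - s)) k)%:E;
  pp_independent : forall (n : nat) (t : nat -> R) (A : nat -> set nat),
    0 <= t 0%N -> {homo t : m1 m2 / (m1 <= m2)%N >-> m1 <= m2} ->
    P (\bigcap_(m < n) [set w | A m (N (t m.+1) w - N (t m) w)%N]) =
    (\prod_(m < n) P [set w | A m (N (t m.+1) w - N (t m) w)%N])%E }.

(* [chi n w <= t] iff [n <= N t w]: with [chi] strictly increasing, [N t w] is
   the number of [n >= 1] with [chi n w <= t].  In particular the paths of [N]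
   are right-continuous with unit jumps, at the times [chi n w], and
   [chi n w] tends to infinity. *)
Record arrival_times (N : R -> T -> nat) (chi : nat -> T -> R) : Prop := {
  arr_start : forall w, chi 0%N w = 0;
  arr_increasing : forall w n, chi n w < chi n.+1 w;
  arr_count : forall w n t, 0 <= t -> (chi n w <= t) = (n <= N t w)%N }.

End PoissonProcess.

Section Chain.
Context {R : realType} {J : nat}.
Implicit Types (Lam : R -> R -> 'M[R]_J) (Q : nat -> nat -> 'M[R]_J).

Definition intensity_matrix (A : 'M[R]_J) : Prop :=
  (forall i j, i != j -> 0 <= A i j) /\ (forall i, \sum_j A i j = 0).

(* The supremum over i of the absolute row sums; the default 0 only matters
   for the empty index set. *)
Definition sup_row_sum (A : 'M[R]_J) : R :=
  \big[Num.max/0]_i \sum_j `|A i j|.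

Definition diag_part (A : 'M[R]_J) : 'M[R]_J :=
  \matrix_(i, j) (A i j *+ (i == j)).

Definition offdiag_part (A : 'M[R]_J) : 'M[R]_J := A - diag_part A.

(* The transition matrices along a given sequence of grid points [x]. *)
Definition Qgrid Lam (g : R) (x : nat -> R) (l w : nat) : 'M[R]_J :=
  1%:M + g^-1 *: Lam (x l.+1) (x l.+1 - x (l - w)%N).

Definition Qtilde Lam (g : R) (l w : nat) : 'M[R]_J :=
  1%:M + g^-1 *: Lam (l.+1%:R / g) (w.+1%:R / g).

Fixpoint PiQ Q (k v : nat) {struct k} : 'M[R]_J :=
  match k, v with
  | 0%N, 0%N => 1%:M
  | 0%N, _.+1 => 0
  | k'.+1, 0%N => \sum_(w < k'.+1) PiQ Q k' w *m offdiag_part (Q k' w)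
  | k'.+1, v'.+1 =>
      if (v' <= k')%N then PiQ Q k' v' *m diag_part (Q k' v') else 0
  end.

Definition pa (g : R) Q (s : R) : 'M[R]_J :=
  \matrix_(i, j)
    (\big[+%R/0]_(0 <= l <oo) (Poi (g * s) l * PiQ Q l l i i) * (i == j)%:R).

(* The sum over pairs l > w >= 0 is taken as the series over l of the finite
   sums over w < l.  The terms are nonnegative when Q is, so the order of
   summation is immaterial. *)
Definition pc (g : R) Q (s v : R) : 'M[R]_J :=
  \matrix_(i, j)
    (\big[+%R/0]_(0 <= l <oo) \sum_(w < l)
       (Erl (l - w) g (s - v) * Poi (g * v) w * PiQ Q l w i j * (v < s)%R%:R)).

End Chain.

(* Main.v *)
Require Import Defs.
From HB Require Import structures.
From mathcomp Require Import all_boot all_order all_algebra.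
From mathcomp Require Import all_classical all_reals all_analysis.
From mathcomp Require Import measurable_realfun.
From mathcomp Require Import ring lra zify.

Set Implicit Arguments.
Unset Strict Implicit.
Unset Printing Implicit Defensive.

Import Order.TTheory GRing.Theory Num.Theory.
Import numFieldNormedType.Exports.

Local Open Scope classical_set_scope.
Local Open Scope ring_scope.

(* Put err_l(i) = sum over w and j of |Pi_ij(l, w) - Pi~_ij(l, w)|.  For each fixed i,
   the entries Pi_ij(l, w) over (w, j) form a probability vector which one step of the
   recursion moves by the row-stochastic matrices Q, so err_(l+1) <= err_l + eta whenever
   the rows of Q(l, w) - Q~(l, w) have absolute sum at most eta; and always err_l <= 2.
   If |chi_l - l / g| <= delta for all l <= M, the Lipschitz condition allows
   eta = 3 K delta / g up to l = M.
   Both distances in the theorem are at most sum_l Poi_(g s)(l) err_l(i): for the second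
   one, the integral of Erl_(l-w)(s - x) Poi_(g x)(w) over 0 <= x <= s is a Beta integral
   equal to Poi_(g s)(l).  With M of order g (s + 1) the sum beyond M is exponentially
   small, and the rest is of order K (s + 1) delta.
   Finally chi_l > t means N_t < l, so Chernoff's bound for Poisson variables gives
   |chi_l - l / g| > delta with probability at most 2 exp (- (g delta)^2 / (16 M)); for
   delta of order g^(-1/2 + eps/2) the union over l <= M is O(g exp (- a g^eps)).
   Hence alpha = 1 works. *)

(** * One-step stability of the recursion for [PiQ] in total variation *)

Section Chain.
Context {R : realType} {J : nat}.
Implicit Types (Q : nat -> nat -> 'M[R]_J).

Definition stochastic_family Q := forall l w, (w <= l)%N ->
  (forall i j, 0 <= Q l w i j) /\ (forall i, \sum_j Q l w i j = 1).

(** At [X = PiQ Q] this is the total mass of the law, after l steps from state i, of the pair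
    (duration w, state j); on a difference of two such families it is their total variation norm. *)
Definition row_mass (X : nat -> nat -> 'M[R]_J) (i : 'I_J) (l : nat) : R :=
  \sum_(w < l.+1) \sum_j `|X l w i j|.

Definition PiQ_dist Q Q' i l := row_mass (fun l w => PiQ Q l w - PiQ Q' l w) i l.

Lemma diag_partE (A : 'M[R]_J) i j : diag_part A i j = A i j *+ (i == j).
Proof. by rewrite mxE. Qed.

Lemma offdiag_partE (A : 'M[R]_J) i j : offdiag_part A i j = A i j *+ (i != j).
Proof. by rewrite !mxE; case: (i == j); rewrite ?subrr ?subr0. Qed.

Lemma PiQ_S0 Q l : PiQ Q l.+1 0 =
  \sum_(w < l.+1) PiQ Q l w *m offdiag_part (Q l w).
Proof. by []. Qed.

Lemma PiQ_SS Q l w : (w <= l)%N ->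
  PiQ Q l.+1 w.+1 = PiQ Q l w *m diag_part (Q l w).
Proof. by move=> wl /=; rewrite wl. Qed.

Lemma offdiag_partB (A B : 'M[R]_J) : offdiag_part (A - B) = offdiag_part A - offdiag_part B.
Proof.
by apply/matrixP => i j; rewrite !(mxE, offdiag_partE); case: (i == j); rewrite /= ?mulr0n ?mulr1n; ring.
Qed.

Lemma diag_partB (A B : 'M[R]_J) : diag_part (A - B) = diag_part A - diag_part B.
Proof.
by apply/matrixP => i j; rewrite !mxE mulrnBl.
Qed.

Lemma norm_diag_offdiag (A : 'M[R]_J) i :
  (\sum_j `|offdiag_part A i j|) + \sum_j `|diag_part A i j| = \sum_j `|A i j|.
Proof.
rewrite -big_split; apply: eq_bigr => j _ /=.
by rewrite offdiag_partE diag_partE; case: (i == j); rewrite /= ?mulr0n ?mulr1n normr0 ?addr0 ?add0r.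
Qed.

Lemma norm_mulmx (A B : 'M[R]_J) i :
  \sum_j `|(A *m B) i j| <= \sum_k `|A i k| * \sum_j `|B k j|.
Proof.
under [leRHS]eq_bigr do rewrite mulr_sumr.
rewrite exchange_big /=; apply: ler_sum => j _.
rewrite mxE (le_trans (ler_norm_sum _ _ _))//.
by apply: ler_sum => k _; rewrite normrM.
Qed.

Lemma PiQ_ge0 Q : stochastic_family Q -> forall l w i j, 0 <= PiQ Q l w i j.
Proof.
move=> SQ; elim=> [|l IH] [|w] i j.
- by rewrite /= !mxE; case: (i == j).
- by rewrite /= mxE.
- rewrite PiQ_S0 summxE sumr_ge0// => w _; rewrite mxE sumr_ge0// => k _.
  rewrite mulr_ge0// offdiag_partE mulrn_wge0//.
  by have [+ _] := SQ l w (leq_ord w); exact.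
- rewrite /=; case: ifPn => wl; last by rewrite mxE.
  rewrite mxE sumr_ge0// => k _; rewrite mulr_ge0// diag_partE mulrn_wge0//.
  by have [+ _] := SQ l w wl; exact.
Qed.

(** The mass at (w, k) goes either to duration 0 through the off-diagonal part of row k or to
    duration w + 1 through the diagonal part; together they make the full row of [Q l w], whose sum
    is 1. *)
Lemma row_mass_PiQ Q i : stochastic_family Q -> forall l, row_mass (PiQ Q) i l = 1.
Proof.
move=> SQ l.
have -> : row_mass (PiQ Q) i l = \sum_(w < l.+1) \sum_j PiQ Q l w i j.
  by apply: eq_bigr => w _; apply: eq_bigr => j _; rewrite ger0_norm// PiQ_ge0.
elim: l => [|l IH].
  rewrite big_ord1 /= (bigD1 i)//= mxE eqxx big1 ?addr0// => j ji.
  by rewrite mxE eq_sym (negbTE ji).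
rewrite big_ord_recl -[RHS]IH.
under eq_bigr do rewrite PiQ_S0 summxE.
rewrite exchange_big/= -big_split/=; apply: eq_bigr => w _.
rewrite (leq_ord w) -big_split/=.
under eq_bigr do rewrite !mxE -big_split/=.
rewrite exchange_big/=; apply: eq_bigr => k _.
under eq_bigr do rewrite -mulrDr !mxE subrK.
by rewrite -mulr_sumr (SQ l w (leq_ord w)).2 mulr1.
Qed.

Lemma PiQ_dist_le2 Q Q' i l : stochastic_family Q -> stochastic_family Q' ->
  PiQ_dist Q Q' i l <= 2.
Proof.
move=> SQ SQ'; have -> : 2 = row_mass (PiQ Q) i l + row_mass (PiQ Q') i l.
  by rewrite !row_mass_PiQ.
rewrite -big_split; apply: ler_sum => w _.
rewrite -big_split; apply: ler_sum => j _.
by rewrite !mxE ler_normB.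
Qed.

(* Splits [A B - A' B'] as [(A - A') B + A' (B - B')]. *)
Lemma norm_mulmxB (A A' B B' : 'M[R]_J) i :
  \sum_j `|(A *m B - A' *m B') i j| <=
  \sum_k (`|(A - A') i k| * \sum_j `|B k j| + `|A' i k| * \sum_j `|(B - B') k j|).
Proof.
have -> : A *m B - A' *m B' = (A - A') *m B + A' *m (B - B').
  by rewrite mulmxBl mulmxBr addrA subrK.
rewrite big_split/=; apply: le_trans (lerD (norm_mulmx _ _ _) (norm_mulmx _ _ _)).
by rewrite -big_split; apply: ler_sum => j _; rewrite mxE ler_normD.
Qed.

(** In the splitting of [norm_mulmxB], the old error is multiplied by rows of Q of sum 1, so it does
    not grow, and the new error is at most eta times the unit mass of [PiQ Q']. The diagonal and
    off-diagonal parts are bounded apart and add up again because their supports are disjoint. *)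
Lemma PiQ_dist_S Q Q' i l eta : stochastic_family Q -> stochastic_family Q' ->
  (forall w, (w <= l)%N -> forall k, \sum_j `|(Q l w - Q' l w) k j| <= eta) ->
  PiQ_dist Q Q' i l.+1 <= PiQ_dist Q Q' i l + eta.
Proof.
move=> SQ SQ' Hd.
pose F (f : 'M[R]_J -> 'M[R]_J) w := \sum_k
  (`|(PiQ Q l w - PiQ Q' l w) i k| * (\sum_j `|f (Q l w) k j|)
  + `|PiQ Q' l w i k| * (\sum_j `|f (Q l w - Q' l w) k j|)).
have -> : PiQ_dist Q Q' i l.+1 = \sum_j `|(PiQ Q l.+1 0 - PiQ Q' l.+1 0) i j| +
   \sum_(w < l.+1) \sum_j `|(PiQ Q l w *m diag_part (Q l w) -
      PiQ Q' l w *m diag_part (Q' l w)) i j|.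
  rewrite /PiQ_dist/row_mass big_ord_recl; congr (_ + _); apply: eq_bigr => w _.
  by rewrite lift0 !PiQ_SS// leq_ord.
have off : \sum_j `|(PiQ Q l.+1 0 - PiQ Q' l.+1 0) i j| <=
    \sum_(w < l.+1) F offdiag_part w.
  apply: (@le_trans _ _ (\sum_(w < l.+1) \sum_j
      `|(PiQ Q l w *m offdiag_part (Q l w) -
         PiQ Q' l w *m offdiag_part (Q' l w)) i j|)).
    rewrite exchange_big/=; apply: ler_sum => j _.
    by rewrite -sumrB summxE ler_norm_sum.
  by apply: ler_sum => w _; apply: le_trans (norm_mulmxB _ _ _ _ _) _; rewrite /F offdiag_partB.
have dia : \sum_(w < l.+1) \sum_j `|(PiQ Q l w *m diag_part (Q l w) -
      PiQ Q' l w *m diag_part (Q' l w)) i j| <= \sum_(w < l.+1) F diag_part w.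
  by apply: ler_sum => w _; apply: le_trans (norm_mulmxB _ _ _ _ _) _; rewrite /F diag_partB.
apply: le_trans (lerD off dia) _.
rewrite -big_split/=.
(* Writing eta as eta times the mass of [PiQ Q'] turns the claim into a comparison term by term in
   (w, k). *)
rewrite -[X in _ + X]mul1r -[X in X * eta](row_mass_PiQ i SQ' l) mulr_suml -big_split/=.
apply: ler_sum => w _; rewrite mulr_suml -!big_split/=; apply: ler_sum => k _.
rewrite addrACA -!mulrDr !norm_diag_offdiag lerD//.
  under [X in _ * X]eq_bigr do rewrite ger0_norm ?(SQ l w (leq_ord w)).1//.
  by rewrite (SQ l w (leq_ord w)).2 mulr1.
by rewrite ler_wpM2l// Hd// leq_ord.
Qed.

Lemma PiQ_dist_le Q Q' i M eta : stochastic_family Q -> stochastic_family Q' ->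
  (forall l w, (w <= l < M)%N -> forall k, \sum_j `|(Q l w - Q' l w) k j| <= eta) ->
  forall l, (l <= M)%N -> PiQ_dist Q Q' i l <= l%:R * eta.
Proof.
move=> SQ SQ' Hd; elim=> [_|l IH lM].
  rewrite mul0r /PiQ_dist/row_mass big_ord1 /= subrr big1// => j _.
  by rewrite mxE normr0.
apply: le_trans (PiQ_dist_S (eta := eta) i SQ SQ' _) _.
  by move=> w wl; apply: Hd; rewrite wl.
by rewrite -natr1 mulrDl mul1r lerD2r IH// ltnW.
Qed.

End Chain.

(** * Exponential moments and tails of Poisson weights *)

Section PoissonSeries.
Context {R : realType}.
Implicit Types (x mu h : R) (n l : nat).

Lemma sum_exp_coeff_le x n : 0 <= x -> \sum_(0 <= l < n) x ^+ l / l`!%:R <= expR x.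
Proof.
move=> x0; apply: (@nondecreasing_cvgn_le _ (series (exp_coeff x))).
  apply/nondecreasing_seqP => k; rewrite /series/= big_nat_recr//= lerDl.
  exact: exp_coeff_ge0.
exact: is_cvg_series_exp_coeff.
Qed.

Lemma Poi_ge0 mu n : 0 <= mu -> 0 <= Poi mu n.
Proof. by move=> mu0; rewrite /Poi !mulr_ge0 ?expR_ge0 ?exprn_ge0 ?invr_ge0. Qed.

(** The moment generating function of the Poisson law: the factor exp (h l) changes mu ^ l into (mu
    exp h) ^ l, and partial sums of the exponential series are below its limit. *)
Lemma sum_Poi_expR_le mu h n : 0 <= mu ->
  \sum_(0 <= l < n) Poi mu l * expR (h * l%:R) <= expR (mu * (expR h - 1)).
Proof.
move=> mu0.
have -> : mu * (expR h - 1) = - mu + mu * expR h by ring.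
rewrite expRD.
have -> : \sum_(0 <= l < n) Poi mu l * expR (h * l%:R) =
    expR (- mu) * \sum_(0 <= l < n) (mu * expR h) ^+ l / l`!%:R.
  rewrite mulr_sumr; apply: eq_bigr => l _.
  by rewrite /Poi expRM_natr exprMn; ring.
by rewrite ler_wpM2l ?expR_ge0// sum_exp_coeff_le// mulr_ge0// expR_ge0.
Qed.

Lemma sum_Poi_le1 mu n : 0 <= mu -> \sum_(0 <= l < n) Poi mu l <= 1.
Proof.
move=> mu0; have := sum_Poi_expR_le 0 n mu0.
rewrite expR0 subrr mulr0 expR0; under eq_bigr do rewrite mul0r expR0 mulr1.
by [].
Qed.

(* From [1 - x <= expR (- x)] and [1 <= (1 - x) (1 + x + 2 x^2)]. *)
Lemma expR_le_quadratic x : x <= 2^-1 -> expR x <= 1 + x + 2 * x ^+ 2.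
Proof.
move=> x2; have h := expR_ge1Dx (- x).
have e0 := expR_gt0 x.
have h2 : expR x * (1 - x) <= 1.
  rewrite -[leRHS](expRxMexpNx_1 x) ler_wpM2l// ltW.
have x1 : 0 < 1 - x by lra.
rewrite -(ler_pM2r x1) (le_trans h2)//.
have : 0 <= x ^+ 2 * (1 - 2 * x) by rewrite mulr_ge0 ?sqr_ge0//; lra.
lra.
Qed.

(** The quadratic bound at 1/2 gives exp (1/2) <= 2, which is then squared. *)
Lemma expR1_le4 : expR 1 <= 4 :> R.
Proof.
have -> : 1 = 2^-1 * 2%:R :> R by rewrite mulVf.
rewrite expRM_natr.
have h := @expR_le_quadratic 2^-1 (lexx _).
have e0 := expR_gt0 (2^-1 : R).
by rewrite expr2; nra.
Qed.

(** Beyond M the error is at most 2 <= 2 exp (l - M), so the exponential moment at h = 1 bounds the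
    tail; the 3 comes from exp 1 - 1 <= 3. *)
Lemma sum_Poi_err_le mu c (M : nat) (err : nat -> R) n :
  0 <= mu -> 0 <= c -> (forall l, err l <= 2) -> (forall l, (l <= M)%N -> err l <= c) ->
  \sum_(0 <= l < n) Poi mu l * err l <= c + 2 * expR (3 * mu - M%:R).
Proof.
move=> mu0 c0 e2 ec.
have E l : err l <= c + 2 * expR (- M%:R) * expR (1 * l%:R).
  have [lM|Ml] := leqP l M.
    by rewrite (le_trans (ec _ lM))// lerDl !mulr_ge0// expR_ge0.
  rewrite -mulrA -expRD (le_trans (e2 l))// -[leLHS]add0r lerD// ler_peMr//.
  have Ml' : (M%:R : R) <= l%:R by rewrite ler_nat ltnW.
  by rewrite -[leLHS]expR0 ler_expR; lra.
apply: (@le_trans _ _ (c * (\sum_(0 <= l < n) Poi mu l) +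
    2 * expR (- M%:R) * \sum_(0 <= l < n) Poi mu l * expR (1 * l%:R))).
  rewrite !mulr_sumr -big_split/=; apply: ler_sum => l _.
  apply: le_trans (ler_wpM2l (Poi_ge0 l mu0) (E l)) _.
  by rewrite le_eqVlt; apply/orP; left; apply/eqP; ring.
rewrite lerD//; first by rewrite ler_piMr// sum_Poi_le1.
rewrite addrC expRD -mulrA ler_wpM2l// ler_wpM2l ?expR_ge0//.
apply: le_trans (sum_Poi_expR_le _ _ mu0) _.
rewrite ler_expR mulrC ler_wpM2r//.
by have := expR1_le4; lra.
Qed.

End PoissonSeries.

(** * Products of Erlang densities and Poisson weights: the Beta integral and the binomial sum *)

Section BetaIntegral.
Context {R : realType}.
Notation leb := (@lebesgue_measure R).

Lemma integral_deriv_poly (p : {poly R}) (a b : R) : a < b ->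
  (\int[leb]_(x in `[a, b]) (p^`().[x])%:E = (p.[b] - p.[a])%:E)%E.
Proof.
move=> ab; rewrite (@continuous_FTC2 _ _ (fun x => p.[x])) ?EFinB//.
- by apply: continuous_subspaceT => x; exact: continuous_horner.
- split.
  + by move=> x _; exact: derivable_horner.
  + by apply: cvg_at_right_filter; exact: continuous_horner.
  + by apply: cvg_at_left_filter; exact: continuous_horner.
- by move=> x _; rewrite derivE.
Qed.

(** Integration by parts as an induction on b: the derivative of x^(a+1) (s-x)^(b+1) / ((a+1)!
    (b+1)!) is the wanted integrand minus the one for (a+1, b). *)
Lemma beta_antiderivative (a b : nat) (s : R) : exists p : {poly R},
  [/\ p^`() = ((a`!%:R * b`!%:R)^-1)%:P * 'X^a * (s%:P - 'X) ^+ b,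
      p.[0] = 0 & p.[s] = s ^+ (a + b).+1 / ((a + b).+1)`!%:R].
Proof.
have nf n : (n`!%:R : R) != 0 by rewrite pnatr_eq0 -lt0n fact_gt0.
have nS n : 1 + (n%:R : R) != 0 by rewrite nat1r pnatr_eq0.
elim: b a => [|b IH] a.
  exists ((a.+1`!%:R^-1)%:P * 'X^(a.+1)); split.
  - have -> : (a`!%:R * 0`!%:R)^-1 = (a.+1`!%:R)^-1 * a.+1%:R :> R.
      by rewrite fact0 mulr1 factS natrM; field; rewrite nf nS.
    by rewrite deriv_mulC derivXn polyCM rmorph_nat; ring.
  - by rewrite !hornerE expr0n mulr0.
  - by rewrite addn0 !hornerE mulrC.
have [p [p1 p2 p3]] := IH a.+1.
exists (((a.+1`!%:R * b.+1`!%:R)^-1)%:P * 'X^(a.+1) * (s%:P - 'X) ^+ b.+1 + p); split.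
- have -> : (a`!%:R * b.+1`!%:R)^-1 = (a.+1`!%:R * b.+1`!%:R)^-1 * a.+1%:R :> R.
    by rewrite !factS !natrM; field; rewrite !nf ?nS.
  have E : (a.+1`!%:R * b`!%:R)^-1 = (a.+1`!%:R * b.+1`!%:R)^-1 * b.+1%:R :> R.
    by rewrite !factS !natrM; field; rewrite !nf ?nS.
  rewrite derivD p1 E derivM deriv_mulC derivXn deriv_exp derivB derivC derivX.
  by rewrite !polyCM !rmorph_nat /= !exprS; ring.
- by rewrite !hornerE p2 expr0n/= mulr0 mul0r addr0.
- by rewrite !hornerE p3 subrr expr0n/= mulr0 add0r addSnnS.
Qed.

(** With b = l - w - 1 the integrand is exp (- g s) g^l x^w (s-x)^b / (w! b!). It is nonnegative on
    [0, s], and its integral over all of [0, s] is exactly [Poi (g * s) l]. *)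
Lemma integral_Erl_Poi_le (g s v : R) (l w : nat) : 0 <= g -> 0 <= v -> v <= s -> (w < l)%N ->
  (\int[leb]_(x in `[0%R, v]) (Erl (l - w) g (s - x) * Poi (g * x) w)%:E
    <= (Poi (g * s) l)%:E)%E.
Proof.
move=> g0 v0 vs wl.
have nf n : (n`!%:R : R) != 0 by rewrite pnatr_eq0 -lt0n fact_gt0.
(* The fundamental theorem of calculus is applied on a nondegenerate interval; for s = 0 the
   integral is over one point. *)
have [sn0|sn0] := eqVneq s 0.
  move: vs; rewrite {1}sn0 => vs.
  have -> : v = 0 by apply/eqP; rewrite eq_le vs v0.
  by rewrite set_itv1 integral_set1 lee_fin Poi_ge0// sn0 mulr0.
have s0 : 0 < s by rewrite lt_neqAle eq_sym sn0 (le_trans v0 vs).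
have [b lwb] : exists b, l = (w + b).+1 by exists (l - w.+1)%N; lia.
have [p [p1 p2 p3]] := beta_antiderivative w b s.
pose P := (expR (- (g * s)) * g ^+ l)%:P * p.
have E x : Erl (l - w) g (s - x) * Poi (g * x) w = P^`().[x].
  rewrite deriv_mulC p1 !(hornerM, hornerC, hornerXn, horner_exp, hornerD, hornerN, hornerX) /Erl /Poi.
  have -> : (l - w).-1 = b by lia.
  have -> : - (g * s) = - (g * (s - x)) + - (g * x) by ring.
  by rewrite expRD lwb exprS exprD !exprMn; field; rewrite !nf.
apply: (@le_trans _ _ (\int[leb]_(x in `[0%R, s]) (P^`().[x])%:E)%E).
  under eq_integral do rewrite E.
  apply: ge0_subset_integral => //=.
  - apply/measurable_EFinP; apply: measurable_funTS; apply: continuous_measurable_fun => x.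
    exact: continuous_horner.
  - move=> x; rewrite /= in_itv/= => /andP[x0 xs].
    rewrite -E lee_fin /Erl mulr_ge0 ?Poi_ge0 ?mulr_ge0 ?expR_ge0 ?exprn_ge0 ?mulr_ge0 ?subr_ge0//.
  - by apply: subset_itvl; rewrite bnd_simp.
rewrite integral_deriv_poly// lee_fin /P !hornerE p2 p3 mulr0 subr0 /Poi lwb exprMn.
by rewrite le_eqVlt; apply/orP; left; apply/eqP; ring.
Qed.

(** The binomial theorem for (g (s-x) + g x)^l. The right-hand side is the density at s of the
    (l+1)-st arrival, split on the left by the number w of arrivals before x. It dominates the terms
    of the series for [pc]. *)
Lemma sum_Erl_Poi (g s x : R) l :
  \sum_(w < l.+1) Erl (l.+1 - w) g (s - x) * Poi (g * x) w = g * Poi (g * s) l.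
Proof.
have nf n : (n`!%:R : R) != 0 by rewrite pnatr_eq0 -lt0n fact_gt0.
have -> : g * Poi (g * s) l = g * expR (- (g * s)) / l`!%:R * (g * (s - x) + g * x) ^+ l.
  by rewrite -mulrDr subrK /Poi; ring.
rewrite exprDn mulr_sumr; apply: eq_bigr => w _.
rewrite /Erl /Poi subSn ?leq_ord//=.
have -> : - (g * s) = - (g * (s - x)) + - (g * x) by ring.
rewrite expRD -mulr_natl.
have := bin_fact (leq_ord w).
move/(congr1 (fun n => n%:R : R)); rewrite !natrM => <-.
have : ('C(l, w)%:R : R) != 0 by rewrite pnatr_eq0 -lt0n bin_gt0 leq_ord.
by move=> ?; field; rewrite !nf.
Qed.

End BetaIntegral.

(** * Distance between sums of series, from bounds on partial sums *)

Section SeriesDistance.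
Context {R : realType}.

Lemma sum_norm_limB_le (J : nat) (a b : 'I_J -> nat -> R) (c : nat -> R) (C : R) :
  (forall j, cvgn (series (a j))) -> (forall j, cvgn (series (b j))) ->
  (forall l, \sum_j `|a j l - b j l| <= c l) ->
  (forall n, \sum_(0 <= l < n) c l <= C) ->
  \sum_j `|limn (series (a j)) - limn (series (b j))| <= C.
Proof.
move=> ca cb abc cC.
pose u n := \sum_j `|series (a j) n - series (b j) n|.
have cu : u @ \oo --> \sum_j `|limn (series (a j)) - limn (series (b j))|.
  apply: cvg_big => [|j _]; first exact: add_continuous.
  by apply: cvg_norm; apply: cvgB; [exact: ca | exact: cb].
rewrite -(cvg_lim _ cu)//; apply: limr_le; first by apply/cvg_ex; eexists; exact: cu.
apply: nearW => n; apply: le_trans (cC n).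
apply: (@le_trans _ _ (\sum_(0 <= l < n) \sum_j `|a j l - b j l|)); last exact: ler_sum.
rewrite exchange_big/=; apply: ler_sum => j _.
by rewrite /series/= -sumrB ler_norm_sum.
Qed.

Lemma nonneg_series_cvg (a : nat -> R) (C : R) : (forall l, 0 <= a l) ->
  (forall n, \sum_(0 <= l < n) a l <= C) -> cvgn (series a).
Proof.
move=> a0 aC; apply: nondecreasing_is_cvgn.
  by apply/nondecreasing_seqP => k; rewrite /series/= big_nat_recr//= lerDl.
by exists C => _ [n _ <-]; exact: aC.
Qed.

End SeriesDistance.

(** * Measurability of Erlang densities and Poisson weights *)

Section Measurability.
Context {R : realType} {d : measure_display} {T : measurableType d}.
Implicit Types (D : set T) (X : T -> R).

Lemma measurable_Erl D n (g : R) X : measurable_fun D X ->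
  measurable_fun D (fun t => Erl n g (X t)).
Proof.
move=> mX; rewrite /Erl; have mg : measurable_fun D (fun t => g * X t) by exact: measurable_funM.
apply: measurable_funM => //; apply: measurable_funM.
  by apply: measurable_funM => //; exact: measurable_funX.
by apply: measurableT_comp => //; exact: measurable_funN.
Qed.

Lemma measurable_Poi D n X : measurable_fun D X ->
  measurable_fun D (fun t => Poi (X t) n).
Proof.
move=> mX; rewrite /Poi; apply: measurable_funM => //; apply: measurable_funM.
  by apply: measurableT_comp => //; exact: measurable_funN.
exact: measurable_funX.
Qed.

End Measurability.

(** * Convergence of the series for [pa] and [pc], and pointwise bounds on their distances *)

Section PartialSums.
Context {R : realType} {J : nat}.
Implicit Types (Q : nat -> nat -> 'M[R]_J) (g s v : R).

Definition pc_term g Q s v (i j : 'I_J) (l : nat) : R :=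
  \sum_(w < l) (Erl (l - w) g (s - v) * Poi (g * v) w * PiQ Q l w i j * (v < s)%R%:R).

Lemma pcE g Q s v i j : pc g Q s v i j = limn (series (pc_term g Q s v i j)).
Proof. by rewrite mxE. Qed.

Lemma paE g Q s i j : pa g Q s i j =
  limn (series (fun l => Poi (g * s) l * PiQ Q l l i i * (i == j)%:R)).
Proof.
rewrite mxE; case: (i == j); rewrite ?mulr1 ?mulr0.
  by congr (limn _); apply/funext => n; apply: eq_bigr => l _; rewrite mulr1.
rewrite [X in limn X](_ : _ = fun=> 0) ?lim_cst//.
by apply/funext => n; apply: big1 => l _; rewrite mulr0.
Qed.

Lemma Erl_ge0 n g s : 0 <= g -> 0 <= s -> 0 <= Erl n g s.
Proof. by move=> g0 s0; rewrite /Erl !mulr_ge0 ?expR_ge0 ?exprn_ge0 ?invr_ge0 ?mulr_ge0. Qed.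

Lemma ErlPoi_ge0 g s v n w : 0 <= g -> 0 <= v <= s -> 0 <= Erl n g (s - v) * Poi (g * v) w.
Proof.
by move=> g0 /andP[v0 vs]; rewrite mulr_ge0 ?Erl_ge0 ?Poi_ge0 ?mulr_ge0 ?subr_ge0.
Qed.

Lemma norm_PiQ_le1 Q l w i j : stochastic_family Q -> (w <= l)%N -> `|PiQ Q l w i j| <= 1.
Proof.
move=> SQ wl; rewrite -(row_mass_PiQ i SQ l) /row_mass.
rewrite (bigD1 (Ordinal (wl : (w < l.+1)%N)))//= (bigD1 j)//= -addrA lerDl.
by rewrite addr_ge0 ?sumr_ge0// => k _; rewrite sumr_ge0.
Qed.

Lemma pc_term_cvg g Q s v i j : stochastic_family Q -> 0 <= g -> 0 <= v <= s ->
  cvgn (series (pc_term g Q s v i j)).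
Proof.
move=> SQ g0 vs; have s0 : 0 <= s by case/andP: vs => v0; exact: le_trans.
apply: (@nonneg_series_cvg _ _ g) => [l|n].
  by rewrite sumr_ge0// => w _; rewrite mulr_ge0// mulr_ge0 ?PiQ_ge0// ErlPoi_ge0.
(* The dominating sequence is shifted by one: the term l = 0 of [pc_term] is an empty sum. *)
pose u l : R := if l is k.+1 then g * Poi (g * s) k else 0.
apply: (@le_trans _ _ (\sum_(0 <= l < n) u l)).
  apply: ler_sum => -[_|l _]; first by rewrite /pc_term big_ord0.
  rewrite /u -(sum_Erl_Poi g s v l); apply: ler_sum => w _.
  rewrite -mulrA ler_piMr ?ErlPoi_ge0// mulr_ile1 ?PiQ_ge0//.
  - by have := norm_PiQ_le1 i j SQ (ltnW (ltn_ord w)); rewrite ger0_norm ?PiQ_ge0.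
  - by case: (v < s)%R => /=; rewrite ?lexx ?ler01.
case: n => [|n]; first by rewrite big_geq.
rewrite big_nat_recl//= add0r -mulr_sumr ler_piMr// sum_Poi_le1// mulr_ge0//.
Qed.

Lemma pa_term_cvg g Q s i j : stochastic_family Q -> 0 <= g -> 0 <= s ->
  cvgn (series (fun l => Poi (g * s) l * PiQ Q l l i i * (i == j)%:R)).
Proof.
move=> SQ g0 s0; have gs : 0 <= g * s by rewrite mulr_ge0.
apply: (@nonneg_series_cvg _ _ 1) => [l|n].
  by rewrite mulr_ge0// mulr_ge0 ?PiQ_ge0 ?Poi_ge0.
apply: le_trans (sum_Poi_le1 n gs); apply: ler_sum => l _.
rewrite -mulrA ler_piMr ?Poi_ge0// mulr_ile1 ?PiQ_ge0//.
- by have := norm_PiQ_le1 i i SQ (leqnn l); rewrite ger0_norm ?PiQ_ge0.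
- by case: (i == j) => /=; rewrite ?lexx ?ler01.
Qed.

Lemma pa_dist_le g Q Q' s C : stochastic_family Q -> stochastic_family Q' ->
  0 <= g -> 0 <= s -> 0 <= C ->
  (forall i n, \sum_(0 <= l < n) Poi (g * s) l * PiQ_dist Q Q' i l <= C) ->
  sup_row_sum (pa g Q s - pa g Q' s) <= C.
Proof.
move=> SQ SQ' g0 s0 C0 HC; rewrite /sup_row_sum.
apply: bigmax_le => // i _.
under eq_bigr do rewrite mxE [X in _ + X]mxE !paE.
apply: (sum_norm_limB_le (c := fun l => Poi (g * s) l * PiQ_dist Q Q' i l)) => //.
- by move=> j; exact: pa_term_cvg.
- by move=> j; exact: pa_term_cvg.
(* Only j = i contributes, and its term is the summand w = l, j = i of [PiQ_dist]. *)
move=> l; rewrite (bigD1 i)//= big1 ?addr0; last first.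
  by move=> j ji; rewrite eq_sym (negbTE ji) !mulr0 subrr normr0.
have P0 : 0 <= Poi (g * s) l by rewrite Poi_ge0// mulr_ge0.
rewrite eqxx !mulr1 -mulrBr normrM ger0_norm// ler_wpM2l//.
rewrite /PiQ_dist /row_mass big_ord_recr/= (bigD1 i)//= !mxE addrCA lerDl.
by rewrite addr_ge0 ?sumr_ge0// => k _; rewrite sumr_ge0.
Qed.

(** Bounds the l-th term of row i of the difference of the [pc]. The index w stops before l, since w
    = l means that no jump has occurred, which is the case covered by [pa]. *)
Definition pc_err g Q Q' s v (i : 'I_J) (l : nat) : R :=
  \sum_(w < l) (Erl (l - w) g (s - v) * Poi (g * v) w) *
    \sum_j `|(PiQ Q l w - PiQ Q' l w) i j|.

Lemma pc_err_ge0 g Q Q' s v i l : 0 <= g -> 0 <= v <= s -> 0 <= pc_err g Q Q' s v i l.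
Proof.
move=> g0 vs; rewrite sumr_ge0// => w _.
by rewrite mulr_ge0 ?ErlPoi_ge0 ?sumr_ge0.
Qed.

(** The bound is an extended real, ready for the exchange of series and integral, so its finiteness
    need not be settled at each v. *)
Lemma pc_dist_le g Q Q' s v i : stochastic_family Q -> stochastic_family Q' ->
  0 <= g -> 0 <= v <= s ->
  ((\sum_j `|pc g Q s v i j - pc g Q' s v i j|)%:E <=
    \sum_(0 <= l <oo) (pc_err g Q Q' s v i l)%:E)%E.
Proof.
move=> SQ SQ' g0 vs.
have e0 l : (0%N <= l)%N -> true -> (0 <= (pc_err g Q Q' s v i l)%:E)%E.
  by move=> _ _; rewrite lee_fin pc_err_ge0.
(* A finite value bounds all partial sums, +oo is trivial, and -oo contradicts the empty partial sum
   0. *)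
have := fun n => nneseries_lim_ge n e0.
case: (\sum_(0 <= l <oo) (pc_err g Q Q' s v i l)%:E)%E => [r|_|H]; last 2 first.
- by rewrite leey.
- by have := H 0%N; rewrite big_geq.
move=> H; rewrite lee_fin; under eq_bigr do rewrite !pcE.
apply: (sum_norm_limB_le (c := pc_err g Q Q' s v i)) => [j|j|l|n].
- exact: pc_term_cvg.
- exact: pc_term_cvg.
- under eq_bigr do rewrite -sumrB.
  apply: (@le_trans _ _ (\sum_(j < J) \sum_(w < l) (Erl (l - w) g (s - v) * Poi (g * v) w) *
     `|(PiQ Q l w - PiQ Q' l w) i j|)); last first.
    rewrite exchange_big/=; apply: ler_sum => w _; by rewrite mulr_sumr.
  apply: ler_sum => j _; apply: le_trans (ler_norm_sum _ _ _) _.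
  apply: ler_sum => w _; rewrite -mulrBl -mulrBr normrM normrM !mxE.
  rewrite (ger0_norm (ErlPoi_ge0 _ _ _ _))// -mulrA ler_wpM2l ?ErlPoi_ge0//.
  by rewrite ler_piMr//; case: (v < s)%R; rewrite ?normr1 ?normr0.
- by rewrite -lee_fin -sumEFin; exact: H.
Qed.

End PartialSums.

(** * Measurability of [pc] in its argument and in the grid jointly *)

Section MeasurablePc.
Context {R : realType} {J : nat} {d : measure_display} {T : measurableType d}.

(** A pointwise limit of measurable partial sums. Both Q and the time X vary with t, so that the
    result serves on an interval with Q fixed and on the product of the sample space with an
    interval. *)
Lemma measurable_pc (D : set T) (Q : T -> nat -> nat -> 'M[R]_J) (X : T -> R) (g s : R) i j :
  0 <= g -> (forall t, D t -> 0 <= X t <= s) -> measurable_fun D X ->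
  (forall t, D t -> stochastic_family (Q t)) ->
  (forall l w k m, (w <= l)%N -> measurable_fun D (fun t => PiQ (Q t) l w k m)) ->
  measurable_fun D (fun t => pc g (Q t) s (X t) i j).
Proof.
move=> g0 Xs mX SQ mQ.
apply: (@measurable_fun_cvg _ _ _ D (fun n t => series (pc_term g (Q t) s (X t) i j) n)).
  move=> n; rewrite /series/=; apply: measurable_sum => l.
  apply: measurable_sum => w; apply: measurable_funM; last first.
    rewrite (_ : (fun t => _) = (fun t => if X t < s then 1 else 0 : R)); last first.
      by apply/funext => t; case: (X t < s).
    by move=> mD; apply: (measurable_fun_if mD) => //; exact: measurable_fun_ltr.
  apply: measurable_funM; last exact: mQ (ltnW (ltn_ord w)).
  apply: measurable_funM; first by apply: measurable_Erl; exact: measurable_funB.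
  by apply: measurable_Poi; exact: measurable_funM.
move=> t Dt; rewrite pcE; apply: pc_term_cvg => //; [exact: SQ | exact: Xs].
Qed.

End MeasurablePc.

(** * The integrated distance between two [pc] families *)

Section IntegralBound.
Context {R : realType} {J : nat}.
Implicit Types (Q : nat -> nat -> 'M[R]_J) (g s v : R).
Notation leb := (@lebesgue_measure R).

Lemma measurable_pc_err D g Q Q' s i l : measurable_fun D (fun v => pc_err g Q Q' s v i l).
Proof.
apply: measurable_sum => w; apply: measurable_funM => //; apply: measurable_funM.
  by apply: measurable_Erl; exact: measurable_funB.
by apply: measurable_Poi; exact: measurable_funM.
Qed.

(** Tonelli exchanges the integral with the series of [pc_err], and each pair (l, w) then
    contributes at most [Poi (g * s) l] times its error, by the Beta integral. *)
Lemma integral_pc_dist_le g Q Q' s v i C :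
  stochastic_family Q -> stochastic_family Q' -> 0 <= g -> 0 <= v <= s ->
  (forall n, \sum_(0 <= l < n) Poi (g * s) l * PiQ_dist Q Q' i l <= C) ->
  (\int[leb]_(x in `[0%R, v])
     (\sum_j `|pc g Q s x i j - pc g Q' s x i j|)%:E <= C%:E)%E.
Proof.
move=> SQ SQ' g0 /andP[v0 vs] HC.
have Ds x : `[0, v]%classic x -> 0 <= x <= s.
  by rewrite /= in_itv/= => /andP[-> /le_trans]; exact.
have mv : measurable `[0, v]%classic by exact: measurable_itv.
apply: (@le_trans _ _ (\int[leb]_(x in `[0%R, v])
    (\sum_(0 <= l <oo) (pc_err g Q Q' s x i l)%:E))%E).
  apply: ge0_le_integral => //.
  - by move=> x _; rewrite lee_fin sumr_ge0.
  - apply/measurable_EFinP; apply: measurable_sum => j.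
    apply: measurableT_comp => //.
    by apply: measurable_funB; apply: measurable_pc.
  - apply: ge0_emeasurable_sum => [l x Dx _|l _].
      by rewrite lee_fin pc_err_ge0// Ds.
    by apply/measurable_EFinP; exact: measurable_pc_err.
  - by move=> x Dx; apply: pc_dist_le => //; exact: Ds.
rewrite integral_nneseries//; last 2 first.
- by move=> l; apply/measurable_EFinP; exact: measurable_pc_err.
- by move=> l x Dx; rewrite lee_fin pc_err_ge0// Ds.
apply: lime_le.
  apply: is_cvg_nneseries => l _ _; apply: integral_ge0 => x Dx.
  by rewrite lee_fin pc_err_ge0// Ds.
apply: nearW => n; apply: (@le_trans _ _ (\sum_(0 <= l < n) Poi (g * s) l * PiQ_dist Q Q' i l)%:E);
  last by rewrite lee_fin.
rewrite -sumEFin; apply: lee_sum => l _.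
rewrite /pc_err; under eq_integral do rewrite -sumEFin.
rewrite ge0_integral_sum//; last 2 first.
- move=> w; apply/measurable_EFinP; apply: measurable_funM => //; apply: measurable_funM.
    by apply: measurable_Erl; exact: measurable_funB.
  by apply: measurable_Poi; exact: measurable_funM.
- by move=> w x Dx; rewrite lee_fin mulr_ge0 ?ErlPoi_ge0 ?sumr_ge0// Ds.
(* [PiQ_dist] has the additional summand w = l, which is nonnegative and is dropped. *)
rewrite /PiQ_dist/row_mass mulr_sumr big_ord_recr/= EFinD -[leLHS]adde0.
apply: leeD; last first.
  by rewrite lee_fin mulr_ge0 ?sumr_ge0// Poi_ge0// mulr_ge0// (le_trans v0).
rewrite -sumEFin; apply: lee_sum => w _.
under eq_integral do rewrite mulrC EFinM.
rewrite ge0_integralZl//; last 3 first.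
- apply/measurable_EFinP; apply: measurable_funM.
    by apply: measurable_Erl; exact: measurable_funB.
  by apply: measurable_Poi; exact: measurable_funM.
- by move=> x Dx; rewrite lee_fin ErlPoi_ge0// Ds.
- by rewrite lee_fin sumr_ge0.
rewrite [in leRHS]mulrC EFinM; apply: lee_wpmul2l; first by rewrite lee_fin sumr_ge0.
exact: integral_Erl_Poi_le.
Qed.

End IntegralBound.

(** * Measurability of a function that is Lipschitz on the nonnegative quadrant *)

Section LipschitzMeasurable.
Context {R : realType} {d : measure_display} {T : measurableType d}.

(** Rounding to multiples of 1/(n+1) leaves countably many values, so composing any f with it
    preserves measurability. *)
Definition grid_floor (n : nat) (x : R) : R := (Num.truncn (x * n.+1%:R))%:R / n.+1%:R.

Lemma grid_floor_ge0 n x : 0 <= grid_floor n x.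
Proof. by rewrite /grid_floor divr_ge0. Qed.

Lemma grid_floor_dist n x : 0 <= x -> `|grid_floor n x - x| <= n.+1%:R^-1.
Proof.
move=> x0; rewrite /grid_floor; have n0 : 0 < n.+1%:R :> R by rewrite ltr0n.
have /andP[h1 h2] := truncn_itv (mulr_ge0 x0 (ltW n0)).
rewrite distrC -{1}(mulfK (lt0r_neq0 n0) x) -mulrBl normrM normfV.
rewrite ger0_norm ?subr_ge0// (ger0_norm (ltW n0)) ler_piMl ?invr_ge0 ?ltW//.
by rewrite ltrBlDl natr1.
Qed.

Lemma measurable_grid_floor2 (f : R -> R -> R) (X Y : T -> R) n :
  measurable_fun setT X -> measurable_fun setT Y ->
  (forall t, 0 <= X t) -> (forall t, 0 <= Y t) ->
  measurable_fun setT (fun t => f (grid_floor n (X t)) (grid_floor n (Y t))).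
Proof.
move=> mX mY X0 Y0.
pose cell (Z : T -> R) k := [set t | Num.truncn (Z t * n.+1%:R) = k].
have mcell (Z : T -> R) k : measurable_fun setT Z -> (forall t, 0 <= Z t) -> measurable (cell Z k).
  move=> mZ Z0.
  have -> : cell Z k = (fun t => Z t * n.+1%:R) @^-1` `[k%:R, k.+1%:R[.
    apply/seteqP; split => t /=; rewrite in_itv/=.
      by move=> <-; apply: truncn_itv; rewrite mulr_ge0.
    exact: truncn_def.
  by rewrite -[X in measurable X]setTI; apply: measurable_funM.
have cellT (Z : T -> R) : \bigcup_k cell Z k = setT.
  by apply/seteqP; split => // t _; exists (Num.truncn (Z t * n.+1%:R)).
rewrite -(cellT X); apply/measurable_fun_bigcup => k; first exact: mcell.
have -> : cell X k = \bigcup_m (cell X k `&` cell Y m) by rewrite -setI_bigcupr cellT setIT.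
apply/measurable_fun_bigcup => m; first by apply: measurableI; exact: mcell.
apply: (eq_measurable_fun (cst (f (k%:R / n.+1%:R) (m%:R / n.+1%:R)))) => //.
by move=> t; rewrite inE /grid_floor => -[/= -> ->].
Qed.

(** Continuity of f is known only for nonnegative arguments, so f is approximated from its values at
    rounded arguments, which stay in the quadrant. *)
Lemma measurable_lipschitz2 (f : R -> R -> R) (K : R) (X Y : T -> R) :
  (forall x x' y y', 0 <= x -> 0 <= x' -> 0 <= y -> 0 <= y' ->
    `|f x y - f x' y'| <= K * (`|x - x'| + `|y - y'|)) -> 0 < K ->
  measurable_fun setT X -> measurable_fun setT Y ->
  (forall t, 0 <= X t) -> (forall t, 0 <= Y t) ->
  measurable_fun setT (fun t => f (X t) (Y t)).
Proof.
move=> fK K0 mX mY X0 Y0.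
apply: (@measurable_fun_cvg _ _ _ _
    (fun n t => f (grid_floor n (X t)) (grid_floor n (Y t)))) => [n|t _].
  exact: measurable_grid_floor2.
have cu : (fun n => K * (harmonic n + harmonic n)) @ \oo --> (K * (0 + 0) : R).
  by apply: cvgMr; apply: cvgD; exact: cvg_harmonic.
rewrite addr0 mulr0 in cu.
apply/cvgrPdist_le => e e0; move/cvgrPdist_le: cu => /(_ e e0); apply: filterS => n.
rewrite sub0r normrN => h; apply: le_trans (fK _ _ _ _ _ _ _ _) _ => //; try exact: grid_floor_ge0.
apply: le_trans h; apply: le_trans (ler_norm _); rewrite ler_wpM2l ?(ltW K0)//.
by rewrite distrC (distrC (Y t)) lerD// grid_floor_dist.
Qed.

End LipschitzMeasurable.

(** * Measurability of [PiQ], of finite maxima and of [pa] *)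

Section MeasurableChain.
Context {R : realType} {J : nat} {d : measure_display} {T : measurableType d}.

Lemma measurable_PiQ (Q : T -> nat -> nat -> 'M[R]_J) :
  (forall l w i j, (w <= l)%N -> measurable_fun setT (fun t => Q t l w i j)) ->
  forall l w i j, measurable_fun setT (fun t => PiQ (Q t) l w i j).
Proof.
move=> mQ; elim=> [|l IH] [|w] i j.
- by [].
- by [].
- under eq_fun do rewrite PiQ_S0 summxE.
  apply: measurable_sum => w; under eq_fun do rewrite mxE.
  apply: measurable_sum => k; apply: measurable_funM => //.
  under eq_fun do rewrite offdiag_partE -mulr_natr.
  by apply: measurable_funM => //; apply: mQ; exact: leq_ord.
- rewrite /=; case: (boolP (w <= l)%N) => // wl; under eq_fun do rewrite mxE.
  apply: measurable_sum => k; apply: measurable_funM => //.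
  under eq_fun do rewrite diag_partE -mulr_natr.
  by apply: measurable_funM => //; exact: mQ.
Qed.

Lemma measurable_bigmaxr (I : Type) (r : seq I) (h : I -> T -> R) :
  (forall i, measurable_fun setT (h i)) ->
  measurable_fun setT (fun t => \big[Num.max/0]_(i <- r) h i t).
Proof.
move=> mh; elim: r => [|i r IH]; first (under eq_fun do rewrite big_nil; exact: measurable_cst).
under eq_fun do rewrite big_cons.
exact: (measurable_maxr (mh i) IH).
Qed.

Lemma measurable_bigmaxe (I : Type) (r : seq I) (h : I -> T -> \bar R) :
  (forall i, measurable_fun setT (h i)) ->
  measurable_fun setT (fun t => \big[maxe/0%E]_(i <- r) h i t).
Proof.
move=> mh; elim: r => [|i r IH]; first (under eq_fun do rewrite big_nil; exact: measurable_cst).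
under eq_fun do rewrite big_cons.
exact: (measurable_maxe (mh i) IH).
Qed.

Lemma measurable_pa (Q : T -> nat -> nat -> 'M[R]_J) g s i j :
  0 <= g -> 0 <= s -> (forall t, stochastic_family (Q t)) ->
  (forall l w k m, measurable_fun setT (fun t => PiQ (Q t) l w k m)) ->
  measurable_fun setT (fun t => pa g (Q t) s i j).
Proof.
move=> g0 s0 SQ mQ.
apply: (@measurable_fun_cvg _ _ _ _ (fun n t =>
   series (fun l => Poi (g * s) l * PiQ (Q t) l l i i * (i == j)%:R) n)).
  move=> n; rewrite /series/=; apply: measurable_sum => l.
  by apply: measurable_funM => //; exact: measurable_funM.
move=> t _; rewrite paE; exact: pa_term_cvg.
Qed.

End MeasurableChain.

(** * Measurability of the two random distances *)

Section MeasurableEvents.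
Context {R : realType} {J : nat} {d : measure_display} {T : measurableType d}.
Notation leb := (@lebesgue_measure R).

Lemma measurable_pa_dist (Q : T -> nat -> nat -> 'M[R]_J)
    (Q' : nat -> nat -> 'M[R]_J) (g s : R) : 0 <= g -> 0 <= s ->
  (forall t, stochastic_family (Q t)) -> stochastic_family Q' ->
  (forall l w i j, (w <= l)%N -> measurable_fun setT (fun t => Q t l w i j)) ->
  measurable_fun setT (fun t => sup_row_sum (pa g (Q t) s - pa g Q' s)).
Proof.
move=> g0 s0 SQ SQ' mQ; apply: measurable_bigmaxr => i; apply: measurable_sum => j.
apply: measurableT_comp => //; under eq_fun do rewrite mxE.
apply: measurable_funD => //; apply: measurable_pa => //.
exact: measurable_PiQ.
Qed.

Lemma measurable_integral_pc_dist (Q : T -> nat -> nat -> 'M[R]_J)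
    (Q' : nat -> nat -> 'M[R]_J) (g s v : R) : 0 <= g -> v <= s ->
  (forall t, stochastic_family (Q t)) -> stochastic_family Q' ->
  (forall l w i j, (w <= l)%N -> measurable_fun setT (fun t => Q t l w i j)) ->
  measurable_fun setT (fun t => \big[maxe/0%E]_(i < J)
          \int[leb]_(x in `[0%R, v])
            (\sum_(j < J) `|pc g (Q t) s x i j - pc g Q' s x i j|)%:E)%E.
Proof.
move=> g0 vs SQ SQ' mQ; apply: measurable_bigmaxe => i.
pose D : set (T * R) := setT `*` `[0, v]%classic.
pose F (z : T * R) : \bar R :=
  (\sum_(j < J) `|pc g (Q z.1) s z.2 i j - pc g Q' s z.2 i j|)%:E.
have mD : measurable D by apply: measurableX.
have Ds (z : T * R) : D z -> 0 <= z.2 <= s.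
  by move=> [_]; rewrite /= in_itv/= => /andP[-> /le_trans]; exact.
have mF : measurable_fun D F.
  apply/measurable_EFinP; apply: measurable_sum => j; apply: measurableT_comp => //.
  apply: measurable_funB; apply: measurable_pc => //.
  - exact: measurable_funTS.
  - move=> l w k m _; apply: measurable_funTS.
    by apply: (measurableT_comp (measurable_PiQ mQ l w k m)).
  - exact: measurable_funTS.
(* Extension by zero outside D gives a nonnegative function on the whole product, whose partial
   integral is measurable by Fubini-Tonelli. *)
have mFD := (measurable_restrictT _ mD).1 mF.
have F0 z : (0 <= (F \_ D) z)%E.
  by apply: erestrict_ge0 => x _; rewrite lee_fin sumr_ge0.
have H := measurable_fun_fubini_tonelli_F (m2 := leb) (F \_ D) mFD F0.
rewrite [X in measurable_fun _ X](_ : _ = fubini_F leb (F \_ D))//.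
apply/funext => t; rewrite integral_mkcond /fubini_F; apply: eq_integral => x _.
rewrite !patchE; congr (if _ then _ else _).
by apply/idP/idP; rewrite !inE /D /=; [split|case].
Qed.

End MeasurableEvents.

(** * Arrival times as random variables *)

Section MeasurableArrival.
Context {R : realType} {d : measure_display} {T : measurableType d}.

Lemma arrival_ge0 (N : R -> T -> nat) chi : arrival_times N chi -> forall n t, 0 <= chi n t.
Proof.
move=> A; elim=> [|n IH] t; first by rewrite (arr_start A).
exact: le_trans (IH t) (ltW (arr_increasing A t n)).
Qed.

Lemma measurable_arrival (N : R -> T -> nat) chi n : arrival_times N chi ->
  (forall t, 0 <= t -> measurable_fun [set: T] (N t)) -> measurable_fun setT (chi n).
Proof.
move=> A mN mD; apply: (measurability _ (RGenOInfty.measurableE R)) => //.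
move=> _ [_ [r ->] <-]; rewrite setTI.
have [r0|r0] := ltP r 0.
  rewrite (_ : _ @^-1` _ = setT)//; apply/seteqP; split => // t _ /=.
  by rewrite in_itv/= andbT (lt_le_trans r0)// (arrival_ge0 A).
rewrite (_ : _ @^-1` _ = N r @^-1` [set k | (k < n)%N]).
  by rewrite -[X in measurable X]setTI; apply: mN.
by apply/seteqP; split => t /=; rewrite in_itv/= andbT ltNge (arr_count A)// -ltnNge.
Qed.

End MeasurableArrival.

(** * Chernoff bounds for arrival times and their union *)

Section PoissonConcentration.
Context {R : realType} {d : measure_display} {T : measurableType d}.
Variables (P : probability T R) (g : R) (N : R -> T -> nat) (chi : nat -> T -> R).
Hypotheses (g0 : 0 < g) (NP : poisson_process P g N) (NA : arrival_times N chi).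

Lemma measurable_count t (A : set nat) : 0 <= t -> measurable [set w | A (N t w)].
Proof.
move=> t0; rewrite [X in measurable X](_ : _ = [set: T] `&` N t @^-1` A); last by rewrite setTI.
exact: (pp_measurable NP).
Qed.

(** Chernoff's bound: on A the weight exp (h k - c) is at least 1. The sign of h is free, so one
    statement covers both tails. *)
Lemma poisson_tail_le (t h c : R) (A : set nat) : 0 <= t ->
  (forall k, A k -> c <= h * k%:R) ->
  (P [set w | A (N t w)] <= (expR (g * t * (expR h - 1) - c))%:E)%E.
Proof.
move=> t0 hA; have gt0 : 0 <= g * t by rewrite mulr_ge0// ltW.
pose F k := [set w | A k /\ N t w = k].
have mF k : measurable (F k).
  exact: (measurable_count (fun m => A k /\ m = k) t0).
have -> : [set w | A (N t w)] = \bigcup_k F k.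
  apply/seteqP; split => w /=; first by move=> Aw; exists (N t w).
  by move=> [k _ [Ak ->]].
apply: (@le_trans _ _ (\sum_(0 <= k <oo) P (F k))%E).
  apply: measure_sigma_subadditive => //; exact: bigcup_measurable.
have PF k : (P (F k) <= (Poi (g * t) k * expR (h * k%:R) * expR (- c))%:E)%E.
  have [Ak|nAk] := pselect (A k); last first.
    have -> : F k = set0 by apply/seteqP; split => // w [].
    by rewrite measure0 lee_fin mulr_ge0 ?expR_ge0// mulr_ge0 ?expR_ge0 ?Poi_ge0.
  rewrite (_ : F k = [set w | (N t w - N 0 w)%N = k]); last first.
    by apply/seteqP; split => w /=; rewrite (pp_start NP) subn0; [case|].
  rewrite (pp_increments NP)// subr0 lee_fin -mulrA -expRD ler_peMr ?Poi_ge0//.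
  by rewrite -[leLHS]expR0 ler_expR subr_ge0 hA.
apply: lime_le; first by apply: is_cvg_nneseries.
apply: nearW => n; apply: (@le_trans _ _ (\sum_(0 <= k < n)
    (Poi (g * t) k * expR (h * k%:R) * expR (- c))%:E)%E).
  by apply: lee_sum => k _.
rewrite sumEFin lee_fin -mulr_suml expRD ler_wpM2r ?expR_ge0//.
exact: sum_Poi_expR_le.
Qed.

(** A late arrival means fewer than l counts at time l/g + delta, an early one at least l counts at
    time l/g - delta. With y = g delta the means there are l + y and l - y, both at most 2 M. *)
Lemma arrival_deviation_le (l M : nat) (delta : R) : 0 < delta -> g * delta <= M%:R ->
  (l <= M)%N ->
  (P [set w | (delta < `|chi l w - l%:R / g|)%R] <=
    (2 * expR (- ((g * delta) ^+ 2 / (16 * M%:R))))%:E)%E.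
Proof.
(* In both tails the quadratic bound on exp leads to the exponent - h y + 4 m h^2, which this h
   minimizes. *)
move=> d0 dM lM; pose y := g * delta; pose m : R := M%:R; pose h := y / (8 * m).
have y0 : 0 < y by rewrite mulr_gt0.
have m0 : 0 < m by apply: lt_le_trans dM.
have h0 : 0 <= h by rewrite divr_ge0// ?mulr_ge0// ltW.
have h2 : h <= 2^-1 by rewrite /h ler_pdivrMr ?mulr_gt0//; have : y <= m by []; lra.
have lm : l%:R <= m by rewrite ler_nat.
have hy : - (h * y) + 4 * m * h ^+ 2 = - (y ^+ 2 / (16 * m)).
  by rewrite /h; field; rewrite gt_eqF.
have l0 : 0 <= (l%:R : R) by [].
have ym : y <= m by [].
have lym : l%:R + y <= 2 * m by clear -lm ym; lra.
have gl : g * (l%:R / g) = l%:R by rewrite mulrC divfK// gt_eqF.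
have up : (P [set w | (l%:R / g + delta < chi l w)%R] <=
    (expR (- (y ^+ 2 / (16 * m))))%:E)%E.
  have t0 : 0 <= l%:R / g + delta by rewrite addr_ge0 ?divr_ge0// ltW.
  rewrite (_ : [set w | _] = [set w | [set k | (k < l)%N] (N (l%:R / g + delta) w)]); last first.
    by apply/seteqP; split => w /=; rewrite ltNge (arr_count NA)// -ltnNge.
  apply: le_trans (poisson_tail_le (h := - h) (c := - h * l%:R) t0 _) _.
    by move=> k /= kl; rewrite !mulNr lerN2 ler_wpM2l// ler_nat ltnW.
  rewrite lee_fin ler_expR -hy (mulrDr g) gl -/y.
  have := @expR_le_quadratic R (- h); rewrite sqrrN => /(_ _) E.
  have {}E : expR (- h) <= 1 - h + 2 * h ^+ 2 by apply: E; lra.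
  have : (l%:R + y) * (expR (- h) - 1) <= (l%:R + y) * (- h + 2 * h ^+ 2).
    by rewrite ler_wpM2l; lra.
  have : (l%:R + y) * (2 * h ^+ 2) <= (2 * m) * (2 * h ^+ 2).
    by apply: ler_wpM2r => //; rewrite mulr_ge0// sqr_ge0.
  lra.
have dn : (P [set w | (chi l w < l%:R / g - delta)%R] <=
    (expR (- (y ^+ 2 / (16 * m))))%:E)%E.
  (* At a negative time the event is empty, arrival times being nonnegative. *)
  have [t0|t0] := leP 0 (l%:R / g - delta); last first.
    rewrite (_ : [set w | _] = set0) ?measure0 ?lee_fin ?expR_ge0//.
    apply/seteqP; split => // w /=; have := arrival_ge0 NA l w; lra.
  apply: (@le_trans _ _ (P [set w | [set k | (l <= k)%N] (N (l%:R / g - delta) w)])).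
    apply: le_measure; rewrite ?inE.
    - rewrite -[X in measurable X]setTI.
      have := @measurable_arrival _ _ _ _ _ l NA (pp_measurable NP).
      move=> /(_ measurableT `]-oo, (l%:R / g - delta)[%classic).
      rewrite (_ : _ @^-1` _ = [set w | chi l w < l%:R / g - delta]); first by apply.
      by apply/seteqP; split => w /=; rewrite in_itv.
    - exact: measurable_count.
    - by move=> w /= /ltW; rewrite (arr_count NA).
  apply: le_trans (poisson_tail_le (h := h) (c := h * l%:R) t0 _) _.
    by move=> k /= kl; rewrite ler_wpM2l// ler_nat.
  rewrite lee_fin ler_expR -hy (mulrBr g) gl -/y.
  have ly : 0 <= l%:R - y by rewrite /y -gl -mulrBr mulr_ge0// ltW.
  have E : expR h <= 1 + h + 2 * h ^+ 2 by exact: expR_le_quadratic.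
  have : (l%:R - y) * (expR h - 1) <= (l%:R - y) * (h + 2 * h ^+ 2).
    by rewrite ler_wpM2l//; lra.
  have : (l%:R - y) * (2 * h ^+ 2) <= (2 * m) * (2 * h ^+ 2).
    by apply: ler_wpM2r; [rewrite mulr_ge0// sqr_ge0|lra].
  lra.
have mc := @measurable_arrival _ _ _ _ _ l NA (pp_measurable NP).
have m1 : measurable [set w | (l%:R / g + delta < chi l w)%R].
  rewrite (_ : mkset _ = setT `&` chi l @^-1` `]l%:R / g + delta, +oo[%classic); first exact: mc.
  by apply/seteqP; split => w /=; rewrite in_itv/= andbT => // -[].
have m2 : measurable [set w | (chi l w < l%:R / g - delta)%R].
  rewrite (_ : mkset _ = setT `&` chi l @^-1` `]-oo, l%:R / g - delta[%classic); first exact: mc.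
  by apply/seteqP; split => w /=; rewrite in_itv/= => // -[].
rewrite (_ : [set w | _] = [set w | (l%:R / g + delta < chi l w)%R] `|`
    [set w | (chi l w < l%:R / g - delta)%R]).
  rewrite mulrDl !mul1r EFinD.
  by apply: le_trans (measureU2 _ m1 m2) _; apply: leeD.
apply/seteqP; split => w /=; rewrite ltr_normr.
  by move=> /orP[H|H]; [left|right]; lra.
by move=> [H|H]; apply/orP; [left|right]; lra.
Qed.

(** An outcome in E has a deviation beyond delta at some l <= M, so E lies in a union of M + 1
    deviation events. *)
Lemma deviation_union_le (E : set T) (M : nat) (delta : R) : 0 < delta -> g * delta <= M%:R ->
  measurable E ->
  (forall w, (forall l, (l <= M)%N -> `|chi l w - l%:R / g| <= delta) -> ~ E w) ->
  (P E <= (2 * M.+1%:R * expR (- ((g * delta) ^+ 2 / (16 * M%:R))))%:E)%E.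
Proof.
move=> d0 dM mE HE.
pose F (l : nat) := [set w | delta < `|chi l w - l%:R / g|].
have mF l : measurable (F l).
  rewrite (_ : F l = setT `&` (fun w => `|chi l w - l%:R / g|) @^-1` `]delta, +oo[%classic).
    have mc := @measurable_arrival _ _ _ _ _ l NA (pp_measurable NP).
    have : measurable_fun setT (fun w => `|chi l w - l%:R / g|).
      by apply: measurableT_comp => //; exact: measurable_funB.
    by apply.
  by apply/seteqP; split => w /=; rewrite in_itv/= andbT => // -[].
have EF : E `<=` \big[setU/set0]_(l < M.+1) F l.
  move=> w Ew; apply: contrapT => nF; apply: (HE w) => // l lM.
  rewrite leNgt; apply/negP => H; apply: nF.
  by rewrite -bigcup_mkord; exists l.
apply: (@le_trans _ _ (P (\big[setU/set0]_(l < M.+1) F l))).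
  by apply: le_measure; rewrite ?inE//; apply: bigsetU_measurable.
apply: le_trans (Boole_inequality P (fun l _ => mF l)) _.
apply: (@le_trans _ _ (\sum_(l < M.+1) (2 * expR (- ((g * delta) ^+ 2 / (16 * M%:R))))%:E)%E).
  by apply: lee_sum => l _; apply: arrival_deviation_le => //; exact: leq_ord.
rewrite sumEFin lee_fin sumr_const card_ord -mulr_natl.
by rewrite le_eqVlt; apply/orP; left; apply/eqP; ring.
Qed.

End PoissonConcentration.

(** * From closeness of the grids to closeness of the transition matrices *)

Section GridComparison.
Context {R : realType} {J : nat}.
Variables (Lam : R -> R -> 'M[R]_J) (gamma0 K : R).
Hypotheses
  (Lam_intensity : forall s v : R, 0 <= s -> 0 <= v -> intensity_matrix (Lam s v))
  (Lam_bounded : forall (s v : R) (i : 'I_J), 0 <= s -> 0 <= v -> `|Lam s v i i| <= gamma0)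
  (Lam_lipschitz : forall s1 s2 v1 v2 : R,
     0 <= s1 -> 0 <= s2 -> 0 <= v1 -> 0 <= v2 ->
     sup_row_sum (Lam s1 v1 - Lam s2 v2) <= K * (`|s1 - s2| + `|v1 - v2|)).

Lemma row_sum_le_sup (A : 'M[R]_J) i : \sum_j `|A i j| <= sup_row_sum A.
Proof. exact: (le_bigmax _ (fun i => \sum_j `|A i j|) i). Qed.

Lemma entry_le_sup_row_sum (A : 'M[R]_J) i j : `|A i j| <= sup_row_sum A.
Proof.
by apply: le_trans (row_sum_le_sup A i); rewrite (bigD1 j)//= lerDl sumr_ge0.
Qed.

Lemma uniformized_stochastic (g s v : R) : 0 < g -> gamma0 <= g -> 0 <= s -> 0 <= v ->
  (forall i j, 0 <= (1%:M + g^-1 *: Lam s v) i j) /\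
  (forall i, \sum_j (1%:M + g^-1 *: Lam s v) i j = 1).
Proof.
move=> g0 gg s0 v0; have [off rs] := Lam_intensity s0 v0; split => [i j|i].
  rewrite !mxE; have [<-|ij] := eqVneq i j.
    have := le_trans (Lam_bounded i s0 v0) gg; rewrite ler_norml => /andP[h _].
    rewrite mulr1n -(ler_pM2l g0) mulr0 mulrDr mulr1 mulrA mulfV ?gt_eqF// mul1r.
    lra.
  by rewrite mulr0n add0r mulr_ge0 ?off// invr_ge0 ltW.
under eq_bigr do rewrite !mxE.
rewrite big_split/= -mulr_sumr rs mulr0 addr0 (bigD1 i)//= eqxx big1 ?addr0//.
by move=> j ji; rewrite eq_sym (negbTE ji).
Qed.

Definition increasing_grid (x : nat -> R) := x 0%N = 0 /\ forall n, x n < x n.+1.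

Lemma grid_le (x : nat -> R) m n : increasing_grid x -> (m <= n)%N -> x m <= x n.
Proof.
move=> [_ xS]; apply: (homo_leq (r := fun a b : R => a <= b)) => //.
  by move=> a b c; exact: le_trans.
by move=> k; exact: ltW.
Qed.

Lemma grid_ge0 (x : nat -> R) n : increasing_grid x -> 0 <= x n.
Proof. by move=> xg; rewrite -xg.1 grid_le. Qed.

Lemma Qgrid_stochastic g x : 0 < g -> gamma0 <= g -> increasing_grid x ->
  stochastic_family (Qgrid Lam g x).
Proof.
move=> g0 gg xg l w wl; apply: uniformized_stochastic => //; first exact: grid_ge0.
by rewrite subr_ge0 grid_le// (leq_trans (leq_subr _ _)).
Qed.

Lemma Qtilde_stochastic g : 0 < g -> gamma0 <= g -> stochastic_family (Qtilde Lam g).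
Proof.
by move=> g0 gg l w wl; apply: uniformized_stochastic => //; rewrite divr_ge0// ltW.
Qed.

(** The 3 counts one delta for the time argument and two for the duration, which is a difference of
    two grid points; on the regular grid w + 1 = (l + 1) - (l - w). *)
Lemma Qgrid_dist_le g x M delta : 0 < g -> 0 < K -> increasing_grid x ->
  (forall l, (l <= M)%N -> `|x l - l%:R / g| <= delta) ->
  forall l w, (w <= l < M)%N -> forall k,
  \sum_j `|(Qgrid Lam g x l w - Qtilde Lam g l w) k j| <= 3 * K * delta / g.
Proof.
move=> g0 K0 xg xd l w /andP[wl lM] k.
have gi : 0 < g^-1 by rewrite invr_gt0.
set A := Lam (x l.+1) (x l.+1 - x (l - w)%N) - Lam (l.+1%:R / g) (w.+1%:R / g).
have -> : Qgrid Lam g x l w - Qtilde Lam g l w = g^-1 *: A.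
  by rewrite /Qgrid /Qtilde opprD addrACA subrr add0r -scalerBr.
have -> : \sum_j `|(g^-1 *: A) k j| = g^-1 * \sum_j `|A k j|.
  by rewrite mulr_sumr; apply: eq_bigr => j _; rewrite !mxE normrM ger0_norm// ltW.
rewrite mulrC ler_wpM2r//; first exact: ltW.
apply: le_trans (row_sum_le_sup A k) _.
have x1 : 0 <= x l.+1 - x (l - w)%N by rewrite subr_ge0 grid_le// (leq_trans (leq_subr _ _)).
have ng0 n : 0 <= n%:R / g by rewrite divr_ge0// ltW.
apply: le_trans (Lam_lipschitz (grid_ge0 _ xg) (ng0 _) x1 (ng0 _)) _.
rewrite [3 * K]mulrC -mulrA ler_wpM2l//; first exact: ltW.
have h1 := xd _ lM; have h2 := xd (l - w)%N (leq_trans (leq_subr _ _) (ltnW lM)).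
have -> : x l.+1 - x (l - w)%N - w.+1%:R / g =
  (x l.+1 - l.+1%:R / g) - (x (l - w)%N - (l - w)%:R / g).
  have -> : w.+1%:R = l.+1%:R - (l - w)%:R :> R by rewrite -natrB; [congr (_%:R); lia|lia].
  ring.
have := ler_normB (x l.+1 - l.+1%:R / g) (x (l - w)%N - (l - w)%:R / g).
lra.
Qed.

Lemma sum_Poi_PiQ_dist_le g x M delta s i n : 0 < g -> gamma0 <= g -> 0 < K -> 0 <= s -> 0 <= delta ->
  increasing_grid x ->
  (forall l, (l <= M)%N -> `|x l - l%:R / g| <= delta) ->
  \sum_(0 <= l < n) Poi (g * s) l * PiQ_dist (Qgrid Lam g x) (Qtilde Lam g) i l <=
  M%:R * (3 * K * delta / g) + 2 * expR (3 * (g * s) - M%:R).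
Proof.
move=> g0 gg K0 s0 d0 xg xd.
have SQ := Qgrid_stochastic g0 gg xg; have SQ' := Qtilde_stochastic g0 gg.
have eta0 : 0 <= 3 * K * delta / g by rewrite divr_ge0 ?mulr_ge0// ltW.
apply: sum_Poi_err_le; [by rewrite mulr_ge0// ltW|by rewrite mulr_ge0| |].
  by move=> l; exact: PiQ_dist_le2.
move=> l lM; apply: le_trans (PiQ_dist_le i SQ SQ' (Qgrid_dist_le g0 K0 xg xd) lM) _.
by rewrite ler_wpM2r// ler_nat.
Qed.

Lemma measurable_Qgrid d (T : measurableType d) (g : R) (chi : nat -> T -> R) l w i j :
  0 < K -> (forall n, measurable_fun setT (chi n)) -> (forall t, increasing_grid (chi ^~ t)) ->
  measurable_fun setT (fun t => Qgrid Lam g (chi ^~ t) l w i j).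
Proof.
move=> K0 mchi chig; rewrite /Qgrid; under eq_fun do rewrite mxE [X in _ + X]mxE.
apply: measurable_funD => //; apply: measurable_funM => //.
apply: (measurable_lipschitz2 (f := fun s v => Lam s v i j) (K := K)) => //.
- move=> x x' y y' x0 x'0 y0 y'0; apply: le_trans (Lam_lipschitz x0 x'0 y0 y'0).
  by have := entry_le_sup_row_sum (Lam x y - Lam x' y') i j; rewrite !mxE.
- exact: measurable_funB.
- by move=> t; exact: (grid_ge0 _ (chig t)).
- by move=> t; rewrite subr_ge0 (grid_le (chig t))// (leq_trans (leq_subr _ _)).
Qed.

End GridComparison.

(** * Stretched exponential decay against powers *)

Section Asymptotics.
Context {R : realType}.

Lemma near_expR_powR_small (a C q e ep : R) : 0 < a -> 0 < ep -> 0 < e ->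
  \forall g \near +oo, C * g * expR (- (a * g `^ ep)) <= e * g `^ (- q).
Proof.
move=> a0 ep0 e0.
(* The term of order n + 1 of the exponential series yields decay g^-(q+2): one power of g cancels
   the factor g, the other absorbs the constants. *)
pose n := (Num.truncn ((q + 2) / ep)).
have nep : q + 2 <= n.+1%:R * ep.
  by rewrite -ler_pdivrMr// ltW// truncnS_gt.
pose A := (n.+1)`!%:R / a ^+ n.+1.
have A0 : 0 < A by rewrite divr_gt0 ?exprn_gt0// ltr0n fact_gt0.
near=> g.
have g1 : 1 <= g by near: g; apply: nbhs_pinfty_ge; exact: num_real.
have gC : `|C| * A / e <= g by near: g; apply: nbhs_pinfty_ge; exact: num_real.
have g0 : 0 < g by lra.
have H : expR (- (a * g `^ ep)) <= A * g `^ (- (q + 2)).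
  rewrite expRN -[leRHS]invrK lef_pV2 ?posrE ?expR_gt0 ?invr_gt0 ?mulr_gt0 ?powR_gt0 ?invr_gt0 ?exprn_gt0//.
  rewrite invfM -powRN opprK /A invf_div.
  have h := @expR_ge1Dxn R (a * g `^ ep) n (mulr_ge0 (ltW a0) (powR_ge0 _ _)).
  apply: le_trans h; rewrite -[leLHS]add0r lerD//.
  rewrite exprMn [leRHS]mulrAC ler_wpM2l ?divr_ge0 ?exprn_ge0 ?(ltW a0)//.
  by rewrite -powR_mulrn ?powR_ge0// -powRrM ler_powR// mulrC.
apply: (@le_trans _ _ (`|C| * g * expR (- (a * g `^ ep)))).
  by rewrite ler_wpM2r ?expR_ge0// ler_wpM2r ?(ltW g0)// ler_norm.
apply: (@le_trans _ _ (`|C| * g * (A * g `^ (- (q + 2))))).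
  by rewrite ler_wpM2l// mulr_ge0// ltW.
have -> : g `^ (- (q + 2)) = g `^ (- q) * g ^- 2.
  have -> : - (q + 2) = - q + - 2 by ring.
  rewrite powRD; last by apply/implyP => _; rewrite gt_eqF.
  by rewrite (powRN g 2) powR_mulrn// ltW.
have -> : `|C| * g * (A * (g `^ (- q) * g ^- 2)) = `|C| * A * g^-1 * g `^ (- q).
  have : g * g^-1 = 1 by rewrite mulfV ?gt_eqF.
  rewrite -exprVn expr2; move: (g^-1) => Z gZ.
  by rewrite -[RHS]mulr1 -gZ; ring.
by rewrite ler_wpM2r ?powR_ge0// ler_pdivrMr// [leRHS]mulrC -ler_pdivrMr.
Unshelve. all: by end_near. Qed.

End Asymptotics.

(** * Choice of the cutoff and of the tolerated deviation *)

Section Scales.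
Context {R : realType}.
Variables (K s eps : R).

(** The cutoff M. Its factor 4 beats the 3 of [sum_Poi_err_le]: 3 g s - M <= - 4 g for nonnegative g
    and s. *)
Definition horizon (g : R) : nat := (Num.truncn (4 * (g * (s + 1)))).+1.

(* A smaller [eps] only lowers the threshold; capping it keeps [g * tolerance g <= horizon g]. *)
Definition capped_eps : R := Num.min eps 2^-1.

(** The deviation delta. Since M <= 5 g (s + 1), the 30 K makes M times 3 K delta / g at most half
    of (s + 1) g^(-1/2 + [capped_eps]/2). *)
Definition tolerance (g : R) : R := g `^ (- 2^-1 + capped_eps / 2) / (30 * K).

Lemma capped_eps_gt0 : 0 < eps -> 0 < capped_eps.
Proof. by move=> eps0; rewrite /capped_eps lt_min eps0 invr_gt0 ltr0n. Qed.

Lemma capped_eps_le : capped_eps <= eps /\ capped_eps <= 2^-1.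
Proof. by rewrite /capped_eps !ge_min !lexx orbT. Qed.

Lemma horizon_bounds (g : R) : 0 <= s -> 1 <= g ->
  4 * (g * (s + 1)) <= (horizon g)%:R /\ (horizon g)%:R <= 5 * (g * (s + 1)).
Proof.
move=> s0 g1; have gs : 1 <= g * (s + 1) by rewrite mulrDr mulr1; have := mulr_ge0 (le_trans ler01 g1) s0; lra.
have h : 0 <= 4 * (g * (s + 1)) by lra.
have /andP[h1 h2] := truncn_itv h.
by split; [exact: ltW|rewrite /horizon -natr1; lra].
Qed.

Lemma tolerance_gt0 (g : R) : 1 <= K -> 0 < g -> 0 < tolerance g.
Proof. by move=> K1 g0; rewrite divr_gt0 ?powR_gt0//; lra. Qed.

Lemma tolerance_le_horizon (g : R) : 1 <= K -> 0 <= s -> 1 <= g -> g * tolerance g <= (horizon g)%:R.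
Proof.
move=> K1 s0 g1; have [h1 _] := horizon_bounds s0 g1.
have gs : g <= g * (s + 1) by rewrite ler_peMr; lra.
have [_ e2] := capped_eps_le.
have P1 : g `^ (- 2^-1 + capped_eps / 2) <= 1.
  by rewrite -[leRHS](powRr0 g) ler_powR//; lra.
have t1 : tolerance g <= 1.
  by rewrite /tolerance ler_pdivrMr; lra.
have : g * tolerance g <= g * 1 by rewrite ler_wpM2l//; lra.
lra.
Qed.

(** Write G for the power of g in [tolerance]. The main part is at most (s + 1) G / 2 and the tail
    at most 1/(2 g) <= G / 2; strictness comes from ln g > 1. The factor 1 is alpha. *)
Lemma error_lt_threshold (g : R) : 1 <= K -> 0 <= s -> 0 < eps -> 1 <= g -> 1 < ln g ->
  (horizon g)%:R * (3 * K * tolerance g / g) + 2 * expR (3 * (g * s) - (horizon g)%:R)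
  < (s + 1) * 1 * ln g * g `^ (- 2^-1 + eps / 2).
Proof.
move=> K1 s0 eps0 g1 lg1; have [h1 h2] := horizon_bounds s0 g1.
have [e1 _] := capped_eps_le; have e0 := capped_eps_gt0 eps0.
have g0 : 0 < g by lra.
pose G := g `^ (- 2^-1 + capped_eps / 2).
have G0 : 0 < G by rewrite powR_gt0.
have GE : G <= g `^ (- 2^-1 + eps / 2) by rewrite ler_powR//; lra.
have gG : g^-1 <= G by rewrite -powR_inv1 ?ler_powR//; lra.
have t1 : (horizon g)%:R * (3 * K * tolerance g / g) <= (s + 1) * G / 2.
  have -> : 3 * K * tolerance g / g = G / 10 / g.
    by rewrite /tolerance -/G; field; rewrite !gt_eqF//; lra.
  have -> : (s + 1) * G / 2 = 5 * (g * (s + 1)) * (G / 10 / g).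
    by field; rewrite gt_eqF.
  by rewrite ler_wpM2r// !divr_ge0// ltW.
have t2 : 2 * expR (3 * (g * s) - (horizon g)%:R) <= g^-1 / 2.
  have gs0 : 0 <= g * s by rewrite mulr_ge0// ltW.
  apply: (@le_trans _ _ (2 * expR (- (4 * g)))).
    by rewrite ler_wpM2l// ler_expR; lra.
  have h := expR_ge1Dx (4 * g).
  rewrite expRN ler_pdivrMr ?expR_gt0//.
  have E : g^-1 / 2 * (4 * g) = 2 by field; rewrite gt_eqF.
  rewrite -[leLHS]E.
  by rewrite ler_wpM2l ?divr_ge0 ?invr_ge0 ?(ltW g0)//; clear -h; lra.
apply: (@le_lt_trans _ _ ((s + 1) * G)).
  have : G <= (s + 1) * G by rewrite ler_peMl; lra.
  lra.
rewrite mulr1 -mulrA ltr_pM2l; last by lra.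
by apply: lt_le_trans (_ : ln g * G <= _); [rewrite ltr_pMl|rewrite ler_wpM2l//; lra].
Qed.

(** The square of g delta is g g^[capped_eps] / (900 K^2); dividing by 16 M with M <= 5 g (s + 1)
    leaves 72000 K^2 (s + 1) in the denominator. *)
Lemma tail_le_exp (g : R) : 1 <= K -> 0 <= s -> 1 <= g ->
  2 * (horizon g).+1%:R * expR (- ((g * tolerance g) ^+ 2 / (16 * (horizon g)%:R))) <=
  (12 * (s + 1)) * g * expR (- ((72 * 10 ^+ 3 * K ^+ 2 * (s + 1))^-1 * g `^ capped_eps)).
Proof.
move=> K1 s0 g1; have [h1 h2] := horizon_bounds s0 g1; have g0 : 0 < g by lra.
have gs : 1 <= g * (s + 1) by rewrite mulrDr mulr1; have := mulr_ge0 (le_trans ler01 g1) s0; lra.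
have K0 : 0 < K by lra.
apply: ler_pM; rewrite ?mulr_ge0 ?expR_ge0//.
  by rewrite -natr1; lra.
rewrite ler_expR lerN2.
pose G := g `^ (- 2^-1 + capped_eps / 2).
have GG : G ^+ 2 = g^-1 * g `^ capped_eps.
  rewrite -powR_mulrn ?powR_ge0// -powRrM -[g^-1]powR_inv1 ?(ltW g0)// -powRD; last first.
    by apply/implyP => _; rewrite gt_eqF.
  by congr (_ `^ _); lra.
pose H : R := (horizon g)%:R; have H0 : 0 < H by rewrite ltr0n.
have -> : (g * tolerance g) ^+ 2 / (16 * H) =
    g / (144 * 10 ^+ 2 * K ^+ 2 * H) * g `^ capped_eps.
  rewrite exprMn /tolerance expr_div_n -/G GG.
  by field; rewrite !gt_eqF.
rewrite ler_wpM2r ?powR_ge0//.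
have s1 : 0 < s + 1 by lra.
have K2 : 0 < K ^+ 2 by rewrite exprn_gt0.
rewrite ler_pdivlMr ?mulr_gt0 ?exprn_gt0// mulrC ler_pdivrMr ?mulr_gt0 ?exprn_gt0//.
have -> : g * (72 * 10 ^+ 3 * K ^+ 2 * (s + 1)) =
  144 * 10 ^+ 2 * K ^+ 2 * (5 * (g * (s + 1))) by ring.
by rewrite ler_wpM2l// ?mulr_ge0// ?exprn_ge0// ltW.
Qed.

End Scales.

(** * Events that force a grid deviation have probability o(g^-q) *)

Section Concentration.
Context {R : realType} {d : measure_display} {T : R -> measurableType d}.

(** Common to both estimates: the event E matters only through its measurability and its failure on
    grids within the tolerance. *)
Lemma littleo_deviation_event (gamma0 K s eps q : R)
  (P : forall g : R, probability (T g) R)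
  (N : forall g : R, R -> T g -> nat) (chi : forall g : R, nat -> T g -> R)
  (E : forall g : R, set (T g)) :
  (forall g : R, gamma0 <= g -> poisson_process (P g) g (@N g)) ->
  (forall g : R, gamma0 <= g -> arrival_times (@N g) (@chi g)) ->
  1 <= K -> 0 <= s -> 0 < eps ->
  (forall g : R, 1 <= g -> gamma0 <= g -> measurable (E g)) ->
  (forall (g : R) (w : T g), 1 <= g -> gamma0 <= g -> 1 < ln g ->
    (forall l, (l <= horizon s g)%N -> `|chi g l w - l%:R / g| <= tolerance K eps g) -> ~ E g w) ->
  (fun g : R => fine (P g (E g))) =o_ (pinfty_nbhs R) (fun g : R => g `^ (- q)).
Proof.
move=> NP NA K1 s0 eps0 mE HE; apply/eqoP => e e0.
have a0 : 0 < (72 * 10 ^+ 3 * K ^+ 2 * (s + 1))^-1.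
  have s1 : 0 < s + 1 by lra.
  have K0 : 0 < K by lra.
  by rewrite invr_gt0 !mulr_gt0 ?exprn_gt0.
near=> g.
have g1 : 1 <= g by near: g; apply: nbhs_pinfty_ge; exact: num_real.
have gg : gamma0 <= g by near: g; apply: nbhs_pinfty_ge; exact: num_real.
have ge : expR 1 < g by near: g; apply: nbhs_pinfty_gt; exact: num_real.
have lg : 1 < ln g by rewrite -[ltLHS]expRK ltr_ln ?posrE ?expR_gt0//; lra.
have g0 : 0 < g by lra.
have Pfin := fin_num_measure (P g) _ (mE g g1 gg).
rewrite ger0_norm ?fine_ge0// ger0_norm ?powR_ge0//.
rewrite -lee_fin fineK//.
apply: le_trans (deviation_union_le g0 (NP g gg) (NA g gg) (tolerance_gt0 eps K1 g0)
  (tolerance_le_horizon eps K1 s0 g1) (mE g g1 gg) (fun w => HE g w g1 gg lg)) _.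
rewrite lee_fin; apply: le_trans (tail_le_exp eps K1 s0 g1) _.
near: g; apply: near_expR_powR_small => //; exact: capped_eps_gt0.
Unshelve. all: by end_near. Qed.

End Concentration.

Theorem theorem4p1 (R : realType) (J : nat)
  (Lam : R -> R -> 'M[R]_J) (gamma0 K : R)
  (gamma0_gt0 : 0 < gamma0)
  (Lam_intensity : forall s v : R, 0 <= s -> 0 <= v -> intensity_matrix (Lam s v))
  (Lam_bounded : forall (s v : R) (i : 'I_J), 0 <= s -> 0 <= v -> `|Lam s v i i| <= gamma0)
  (K_gt0 : 0 < K)
  (Lam_lipschitz : forall s1 s2 v1 v2 : R,
     0 <= s1 -> 0 <= s2 -> 0 <= v1 -> 0 <= v2 ->
     sup_row_sum (Lam s1 v1 - Lam s2 v2) <= K * (`|s1 - s2| + `|v1 - v2|))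
  (d : measure_display) (T : R -> measurableType d)
  (P : forall g : R, probability (T g) R)
  (N : forall g : R, R -> T g -> nat)
  (chi : forall g : R, nat -> T g -> R)
  (N_poisson : forall g : R, gamma0 <= g -> poisson_process (P g) g (@N g))
  (chi_arrivals : forall g : R, gamma0 <= g -> arrival_times (@N g) (@chi g))
  (q eps : R) (q_gt1 : 1 < q) (eps_gt0 : 0 < eps) :
  exists alpha : R, forall s v : R, 0 <= v -> v <= s ->
    (fun g : R => fine (P g [set w |
        (s + 1) * alpha * ln g * g `^ (- 2^-1 + eps / 2) <=
        sup_row_sum (pa g (Qgrid Lam g (fun n => @chi g n w)) s
                     - pa g (Qtilde Lam g) s)]))
      =o_ (pinfty_nbhs R) (fun g : R => g `^ (- q))
    /\
    (fun g : R => fine (P g [set w |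
        (((s + 1) * alpha * ln g * g `^ (- 2^-1 + eps / 2))%:E <=
        \big[maxe/0]_(i < J)
          \int[lebesgue_measure]_(v' in `[0%R, v])
            (\sum_(j < J)
              `|pc g (Qgrid Lam g (fun n => @chi g n w)) s v' i j
                - pc g (Qtilde Lam g) s v' i j|)%:E)%E]))
      =o_ (pinfty_nbhs R) (fun g : R => g `^ (- q)).
Proof.
(* K + 1 is also a Lipschitz constant, and being at least 1 it keeps the tolerance below 1. *)
have K1 : 1 <= K + 1 by lra.
have K10 : 0 < K + 1 by lra.
have Lip : forall s1 s2 v1 v2 : R, 0 <= s1 -> 0 <= s2 -> 0 <= v1 -> 0 <= v2 ->
    sup_row_sum (Lam s1 v1 - Lam s2 v2) <= (K + 1) * (`|s1 - s2| + `|v1 - v2|).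
  move=> s1 s2 v1 v2 h1 h2 h3 h4; apply: le_trans (Lam_lipschitz _ _ _ _ h1 h2 h3 h4) _.
  by rewrite ler_wpM2r ?addr_ge0//; lra.
(* The constants are absorbed by [tolerance], so 1 serves for all q and eps. *)
exists 1 => s v v0 vs; have s0 : 0 <= s by exact: le_trans vs.
have grid g (w : T g) : gamma0 <= g -> increasing_grid (fun n => @chi g n w).
  by move=> gg; split; [exact: (arr_start (chi_arrivals _ gg))|exact: (arr_increasing (chi_arrivals _ gg))].
have pos g : gamma0 <= g -> 0 < g by exact: lt_le_trans.
have SQ g (w : T g) (gg : gamma0 <= g) :=
  Qgrid_stochastic Lam_intensity Lam_bounded (pos _ gg) gg (grid g w gg).
have SQ' g (gg : gamma0 <= g) := Qtilde_stochastic Lam_intensity Lam_bounded (pos _ gg) gg.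
have mchi g n (gg : gamma0 <= g) :=
  @measurable_arrival _ _ _ _ _ n (chi_arrivals _ gg) (pp_measurable (N_poisson _ gg)).
have mQ g (gg : gamma0 <= g) l w i j :=
  measurable_Qgrid Lip g l w i j K10 (fun n => mchi g n gg) (fun t => grid g t gg).
(* On a grid within the tolerance, one C below the threshold bounds the Poisson-weighted error,
   hence both distances. *)
have err g (w : T g) : 1 <= g -> gamma0 <= g -> 1 < ln g ->
    (forall l, (l <= horizon s g)%N -> `|chi g l w - l%:R / g| <= tolerance (K + 1) eps g) ->
    exists C, [/\ 0 <= C, C < (s + 1) * 1 * ln g * g `^ (- 2^-1 + eps / 2) &
     forall i n, \sum_(0 <= l < n) Poi (g * s) l *
       PiQ_dist (Qgrid Lam g (fun n => @chi g n w)) (Qtilde Lam g) i l <= C].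
  move=> g1 gg lg xd; have g0 := pos _ gg.
  have t0 := tolerance_gt0 eps K1 g0.
  exists ((horizon s g)%:R * (3 * (K + 1) * tolerance (K + 1) eps g / g) +
    2 * expR (3 * (g * s) - (horizon s g)%:R)); split.
  - apply: addr_ge0; last by rewrite mulr_ge0// expR_ge0.
    by rewrite mulr_ge0// divr_ge0 ?(ltW g0)// mulr_ge0 ?(ltW t0)// mulr_ge0// ltW.
  - exact: error_lt_threshold.
  - move=> i n; apply: (sum_Poi_PiQ_dist_le Lam_intensity Lam_bounded Lip) => //; [exact: ltW|exact: grid].
split.
- apply: (littleo_deviation_event (E := fun g => [set w |
      (s + 1) * 1 * ln g * g `^ (- 2^-1 + eps / 2) <=
      sup_row_sum (pa g (Qgrid Lam g (fun n => chi g n w)) s - pa g (Qtilde Lam g) s)])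
    q N_poisson chi_arrivals K1 s0 eps_gt0) => [g g1 gg|g w g1 gg lg xd].
    have m := measurable_pa_dist (ltW (pos _ gg)) s0 (fun w => SQ g w gg) (SQ' g gg)
      (fun l w i j _ => mQ g gg l w i j).
    rewrite -[X in measurable X]setTI.
    apply: (measurable_fun_ler (f := cst _) _ m) => //.
  have [C [C0 Ct HC]] := err _ w g1 gg lg xd.
  apply/negP; rewrite -ltNge; apply: le_lt_trans Ct.
  by apply: pa_dist_le => //; [exact: SQ|exact: SQ'|exact: ltW (pos _ gg)].
- apply: (littleo_deviation_event (E := fun g => [set w |
      (((s + 1) * 1 * ln g * g `^ (- 2^-1 + eps / 2))%:E <=
      \big[maxe/0]_(i < J) \int[lebesgue_measure]_(v' in `[0%R, v])
        (\sum_(j < J) `|pc g (Qgrid Lam g (fun n => chi g n w)) s v' i j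
           - pc g (Qtilde Lam g) s v' i j|)%:E)%E])
    q N_poisson chi_arrivals K1 s0 eps_gt0) => [g g1 gg|g w g1 gg lg xd].
    have m := measurable_integral_pc_dist (ltW (pos _ gg)) vs (fun w => SQ g w gg) (SQ' g gg)
      (fun l w i j _ => mQ g gg l w i j).
    rewrite -[X in measurable X]setTI.
    exact: emeasurable_fun_c_infty.
  have [C [C0 Ct HC]] := err _ w g1 gg lg xd.
  apply/negP; rewrite -ltNge; apply: (@le_lt_trans _ _ C%:E); last by rewrite lte_fin.
  (* The default 0 of the maximum is covered by 0 <= C. *)
  apply: bigmax_le => [|i _]; first by rewrite lee_fin.
  apply: integral_pc_dist_le => //; [exact: SQ|exact: SQ'|exact: ltW (pos _ gg)|by rewrite v0].
Qed.
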